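(* Let $K$ be a compact abelian group, dual to a discrete ordered abelian group $\Gamma$, with normalized Haar measure $\sigma$. Let $\mathcal{M}$ be a closed subspace of $L^2(d\sigma)$ with $\mathcal{M}_-\subsetneq\mathcal{M}$. If $\mathcal{M}$ is invariant under the semigroup of characters $\{\chi_\lambda\}_{\lambda\ge 0}$ (that is, $\chi_\lambda\mathcal{M}\subseteq\mathcal{M}$ for all $\lambda\in\Gamma_+\cup\{0\}$), then $$\mathcal{M}=\varphi H^2(d\sigma),$$ where $\varphi$ is a $\sigma$-measurable function on $K$ and $|\varphi(x)|=1$ almost everywhere.
   Context: For $\lambda\in\Gamma$, $\chi_\lambda$ is the character of $K$ given by $\chi_\lambda(x)=x(\lambda)$. The order on $\Gamma$ is given by a semigroup $\Gamma_+\subseteq\Gamma$ such that $\Gamma$ is the disjoint union $\Gamma_+\cup\{0\}\cup\Gamma_-$ with $\Gamma_-=-\Gamma_+$; elements of $\Gamma_+$ are called positive ($\lambda>0$), elements of $\Gamma_-$ negative ($\lambda<0$). The Fourier coefficients of $f\in L^1(d\sigma)$ are $a_\lambda(f)=\int_K f\,\overline{\chi_\lambda}\,d\sigma$. $H^2(d\sigma)$ is the subspace of those $f\in L^2(d\sigma)$ with $a_\lambda(f)=0$ for all $\lambda<0$. For a subspace $\mathcal{M}$ of $L^2(d\sigma)$, $\mathcal{M}_-$ is the $L^2$-closure of the linear span of $\bigcup_{\lambda>0}\chi_\lambda\mathcal{M}$. *)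

(* Defs.v *)
From HB Require Import structures.
From mathcomp Require Import all_boot all_order all_algebra.
From mathcomp Require Import complex.
From mathcomp Require Import all_classical all_reals all_analysis.

Set Implicit Arguments.
Unset Strict Implicit.
Unset Printing Implicit Defensive.
Import Order.TTheory GRing.Theory Num.Theory.
Import numFieldNormedType.Exports.

Local Open Scope classical_set_scope.
Local Open Scope ring_scope.
Local Open Scope complex_scope.

Record group_order (Gam : zmodType) (pos : set Gam) : Prop := GroupOrder {
  pos_add : forall l m, pos l -> pos m -> pos (l + m);
  pos_cover : pos `|` [set 0] `|` -%R @` pos = setT;
  pos_neq0 : pos `&` [set 0] = set0;
  neg_neq0 : -%R @` pos `&` [set 0] = set0;
  pos_neg : pos `&` -%R @` pos = set0 }.

Record is_character (R : realType) (Gam : zmodType) (c : Gam -> R[i]) : Prop :=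
  IsCharacter {
    charD : forall l m, c (l + m) = c l * c m;
    char_norm1 : forall l, `|c l| = 1 }.

(* [ev] exhibits [K] as the Pontryagin dual of the discrete group [Gam]:
   [x |-> ev x] is an isomorphism of topological groups from [K] (written
   additively) onto the group of characters of [Gam], whose topology, the
   compact-open one, is that of pointwise convergence since [Gam] is
   discrete. *)
Record is_dual (R : realType) (K : topologicalZmodType) (Gam : zmodType)
    (ev : K -> Gam -> R[i]) : Prop := IsDual {
  dual_char : forall x, is_character (ev x);
  dualD : forall x y l, ev (x + y) l = ev x l * ev y l;
  dual_inj : injective ev;
  dual_surj : forall c, is_character c -> exists x, ev x = c;
  dual_top : forall A : set K,
    open A <-> exists2 B : set {ptws Gam -> R[i]^o}, open B & A = ev @^-1` B }.

Definition chi (R : realType) (K : Type) (Gam : zmodType)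
  (ev : K -> Gam -> R[i]) (l : Gam) : K -> R[i] := fun x => ev x l.

(* A [g_sigma_algebraType] is a measurable type only over a pointed type, and a
   [topologicalZmodType] carries no point: take [0]. *)
Definition pointed_at0 (K : topologicalZmodType) : Type := K.
HB.instance Definition _ (K : topologicalZmodType) :=
  Choice.copy (pointed_at0 K) K.
HB.instance Definition _ (K : topologicalZmodType) :=
  isPointed.Build (pointed_at0 K) (0 : K).

Notation borel K :=
  (@g_sigma_algebraType (pointed_at0 K) (@open K)).

(* For a non-metrizable [K], regularity is not automatic and is part of the
   definition of Haar measure. *)
Record normalized_haar (R : realType) (K : topologicalZmodType)
    (sigma : probability (borel K) R) : Prop := NormalizedHaar {
  haar_invariant : forall (x : K) (A : set (borel K)), measurable A ->
    sigma [set (x + y : K) | y in A] = sigma A;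
  haar_outer : forall A : set (borel K), measurable A ->
    sigma A =
      ereal_inf [set sigma U | U in [set U : set K | open U /\ A `<=` U]];
  haar_inner : forall A : set (borel K), measurable A ->
    sigma A = ereal_sup
      [set sigma C | C in [set C : set K | compact C /\ C `<=` A]] }.

Definition linear_span (R : realType) (T : Type) (S : set (T -> R[i])) :
    set (T -> R[i]) :=
  [set f | exists (n : nat) (c : 'I_n -> R[i]) (g : 'I_n -> T -> R[i]),
     (forall i, S (g i)) /\ f = (fun x => \sum_(i < n) c i * g i x)].

Definition mulset (R : realType) (T : Type) (f : T -> R[i])
    (S : set (T -> R[i])) : set (T -> R[i]) :=
  [set (fun x => f x * g x) | g in S].

Section L2.
Context {R : realType} {d : measure_display} {T : measurableType d}.
Variable mu : {measure set T -> \bar R}.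
Implicit Types (f g : T -> R[i]) (S : set (T -> R[i])).

Definition cmeasurable f :=
  measurable_fun [set: T] (fun x => complex.Re (f x)) /\
  measurable_fun [set: T] (fun x => complex.Im (f x)).

Definition cintegral f : R[i] :=
  (\int[mu]_x complex.Re (f x))%R +i* (\int[mu]_x complex.Im (f x))%R.

Definition L2norm f : \bar R :=
  Lnorm mu 2%:E (fun x => (ComplexField.Normc.normc (f x))%:E).

(* [L2] is a set of functions, not of classes modulo a.e. equality.  The
   subspaces of the quotient are represented by their preimages, that is by sets
   of functions saturated for a.e. equality; [L2closure S] is always saturated
   since [L2norm (f - g) = 0] whenever [f] and [g] are a.e. equal. *)
Definition L2 : set (T -> R[i]) :=
  [set f | cmeasurable f /\ (L2norm f < +oo)%E].

Definition L2closure S : set (T -> R[i]) :=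
  [set f | L2 f /\ forall e : R, 0 < e ->
     exists2 g, S g & (L2norm (fun x => f x - g x)%R < e%:E)%E].

Record closed_subspace S : Prop := ClosedSubspace {
  csub_L2 : S `<=` L2;
  csub0 : S (fun=> 0);
  csub_lin : forall (a : R[i]) f g, S f -> S g -> S (fun x => a * f x + g x);
  csub_closed : L2closure S `<=` S }.

(* The preimage in [L2] of the set of classes of the products [f * g], [g] in
   [S]. *)
Definition ae_mulset f S : set (T -> R[i]) :=
  [set h | L2 h /\
     exists2 g, S g & {ae mu, forall x, h x = f x * g x}].

End L2.

Section Hardy.
Context {R : realType} {K : topologicalZmodType} {Gam : zmodType}.
Variables (ev : K -> Gam -> R[i]) (pos : set Gam).
Variable sigma : probability (borel K) R.

Definition fourier (f : borel K -> R[i]) (l : Gam) : R[i] :=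
  cintegral sigma (fun x => f x * conjc (chi ev l x)).

Definition H2 : set (borel K -> R[i]) :=
  [set f | L2 sigma f /\ forall l, (-%R @` pos) l -> fourier f l = 0].

Definition Mminus (M : set (borel K -> R[i])) : set (borel K -> R[i]) :=
  L2closure sigma (linear_span (\bigcup_(l in pos) mulset (chi ev l) M)).

End Hardy.

(* Main.v *)
(** Pick [phi] of norm 1 in [M], orthogonal to [Mminus M]: since it is
    orthogonal to [chi l * phi] for all [l > 0], the function [|phi|^2 - 1] has
    no Fourier coefficients, so [|phi| = 1] a.e. If [f] is in [M] then [phi] is
    orthogonal to [chi l * f] for [l > 0], so [f * conj phi] is in [H2].
    Conversely, for [g] in [H2], the component of [phi * g] orthogonal to [M] is
    [phi * k] with [k] in [H2]; it is orthogonal to [phi * chi l] for [l >= 0],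
    so all the Fourier coefficients of [k] vanish and [k = 0] a.e.

    The inputs are the projection theorem in [L2] and the uniqueness of Fourier
    coefficients in [L1]. For the latter, the functions [p] such that
    multiplication by [p] preserves the vanishing of all Fourier coefficients
    form an algebra containing the characters, in which indicators of Borel sets
    can be approximated by a Brosowski-Deutsch argument and the regularity of
    [sigma]. *)
Require Import Defs.
From mathcomp Require Import all_boot all_order all_algebra.
From mathcomp Require Import complex.
From mathcomp Require Import all_classical all_reals all_analysis.
From mathcomp Require Import measurable_realfun ring lra.
Import Order.TTheory GRing.Theory Num.Theory.
Import numFieldNormedType.Exports.
Local Open Scope classical_set_scope.
Local Open Scope ring_scope.
Local Open Scope complex_scope.
Set Implicit Arguments.
Unset Strict Implicit.
Unset Printing Implicit Defensive.

(** * Completeness of real L2 *)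

Section square_integrable.
Context {R : realType} {d : measure_display} {T : measurableType d}.
Variable mu : {measure set T -> \bar R}.
Implicit Types f g : T -> R.

Lemma integrableZ_EFin (k : R) f : mu.-integrable [set: T] (EFin \o f) ->
  mu.-integrable [set: T] (EFin \o (fun x => k * f x)).
Proof.
move=> /(integrableZl measurableT k).
by apply: eq_integrable => // x _; rewrite /= EFinM.
Qed.

Lemma integrableD_EFin f g : mu.-integrable [set: T] (EFin \o f) ->
  mu.-integrable [set: T] (EFin \o g) ->
  mu.-integrable [set: T] (EFin \o (fun x => f x + g x)).
Proof.
move=> fi gi; have := integrableD measurableT fi gi.
by apply: eq_integrable => // x _; rewrite /= EFinD.
Qed.

Definition sqint f := measurable_fun [set: T] f /\
  mu.-integrable [set: T] (EFin \o (fun x => f x ^+ 2)).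

(** Domination: [|f g| <= f^2 + g^2], read off from the squares of [f + g] and [f - g]. *)
Lemma sqint_mul f g : sqint f -> sqint g ->
  mu.-integrable [set: T] (EFin \o (fun x => f x * g x)).
Proof.
move=> [mf f2] [mg g2].
apply: (le_integrable measurableT _ _ (integrableD measurableT f2 g2)).
  by apply/measurable_EFinP; exact: measurable_funM.
move=> x _ /=; rewrite lee_fin (ger0_norm (addr_ge0 (sqr_ge0 _) (sqr_ge0 _))).
have := sqr_ge0 (f x - g x); have := sqr_ge0 (f x + g x).
by move=> h1 h2; rewrite ler_norml; nra.
Qed.

Lemma sqintD f g : sqint f -> sqint g -> sqint (fun x => f x + g x).
Proof.
move=> sf sg; have [[mf f2] [mg g2]] := (sf, sg).
split; first exact: measurable_funD.
have fg := sqint_mul sf sg.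
have := integrableD measurableT (integrableD measurableT f2 g2)
  (integrableD measurableT fg fg).
by apply: eq_integrable => // x _ /=; congr (_%:E); ring.
Qed.

Lemma sqintZ (a : R) f : sqint f -> sqint (fun x => a * f x).
Proof.
move=> [mf f2]; split; first exact: measurable_funM.
have := integrableZl measurableT (a ^+ 2) f2.
by apply: eq_integrable => // x _ /=; rewrite -EFinM; congr (_%:E); ring.
Qed.

Lemma sqintB f g : sqint f -> sqint g -> sqint (fun x => f x - g x).
Proof.
move=> sf sg; have := sqintD sf (sqintZ (-1) sg).
by congr sqint; apply/funext => x; rewrite mulN1r.
Qed.

Lemma Rintegral_EFin f : mu.-integrable [set: T] (EFin \o f) ->
  ((\int[mu]_x f x)%:E = \int[mu]_x (f x)%:E)%E.
Proof. by move=> fi; rewrite /Rintegral fineK//; exact: integrable_fin_num. Qed.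

(* AM-GM: [|t| <= 2^-n + 2^n t^2]. *)
Lemma cvg_of_weighted_squares (u : R^nat) :
  (\sum_(n <oo) (2 ^+ n * (u n.+1 - u n) ^+ 2)%:E < +oo)%E -> cvgn u.
Proof.
move=> ufin.
have c1 : cvgn (series (fun n => 2 ^+ n * (u n.+1 - u n) ^+ 2)).
  apply: nnseries_is_cvg ufin => i.
  by apply: mulr_ge0; [exact: exprn_ge0|exact: sqr_ge0].
have c2 : cvgn (series (fun n => 2^-1 ^+ n : R)).
  have -> : (fun n => 2^-1 ^+ n : R) = geometric (1 : R) 2^-1.
    by apply/funext => n; rewrite -[RHS]/(1 * 2^-1 ^+ n) mul1r.
  by apply: is_cvg_geometric_series; rewrite ger0_norm; lra.
have c3 : cvgn (series (fun n => u n.+1 - u n)).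
  apply: normed_cvg.
  apply: (@series_le_cvg _ _ _ _ _ _ (is_cvg_seriesD c2 c1)).
  - by move=> n; exact: normr_ge0.
  - move=> n; apply: addr_ge0; last first.
      by apply: mulr_ge0; [exact: exprn_ge0|exact: sqr_ge0].
    by rewrite exprn_ge0// invr_ge0.
  move=> n; rewrite -[leRHS]/(2^-1 ^+ n + 2 ^+ n * (u n.+1 - u n) ^+ 2) exprVn.
  rewrite -[leLHS]/`|u n.+1 - u n|.
  set t := u _ - _; have a0 : (0 : R) < 2 ^+ n by rewrite exprn_gt0.
  set a := 2 ^+ n in a0 *; rewrite -[_ + _]/(a^-1 + a * t ^+ 2).
  have -> : a^-1 + a * t ^+ 2 = (1 + (a * `|t|) ^+ 2) / a.
    by rewrite exprMn real_normK ?num_real//; field; rewrite gt_eqF.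
  by rewrite ler_pdivlMr//; have := sqr_ge0 (a * `|t| - 1); nra.
have := c3.
rewrite -/(cvgn _) (_ : series _ = (fun n => u n - u 0%N)).
  move=> /(is_cvgD (is_cvg_cst (u 0%N))).
  by congr (cvgn _); apply/funext => n; rewrite fctE addrC subrK.
by apply/funext => n; rewrite /series/= telescope_sumr.
Qed.

(** Riesz-Fischer for geometrically Cauchy sequences. The increments, squared and weighted by [2^n],
    have an integrable sum, so the sequence converges wherever this sum is finite, hence a.e.
    Fatou's lemma then carries the Cauchy bound to the limit with the same constant. *)
Lemma sqint_complete (u : nat -> T -> R) : (forall n, sqint (u n)) ->
  (forall n m, (n <= m)%N -> \int[mu]_x (u m x - u n x) ^+ 2 <= 4^-1 ^+ n) ->
  exists2 v, sqint v & forall n, \int[mu]_x (u n x - v x) ^+ 2 <= 4^-1 ^+ n.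
Proof.
move=> su du.
pose D n x : \bar R := (2 ^+ n * (u n.+1 x - u n x) ^+ 2)%:E.
have D0 n x : (0 <= D n x)%E.
  by rewrite lee_fin mulr_ge0 ?sqr_ge0 ?exprn_ge0.
have mD n : measurable_fun [set: T] (D n).
  apply/measurable_EFinP/measurable_funM => //.
  by have [] := sqintB (su n.+1) (su n) => ? _; exact: measurable_funX.
pose S x := (\sum_(n <oo) D n x)%E.
have mS : measurable_fun [set: T] S by exact: ge0_emeasurable_sum.
have iD n : (\int[mu]_x D n x <= (2^-1 ^+ n)%:E)%E.
  rewrite /D; under eq_integral do rewrite EFinM.
  have [_ i2] := sqintB (su n.+1) (su n).
  rewrite integralZl// -Rintegral_EFin// -EFinM lee_fin.
  rewrite (_ : 2^-1 ^+ n = 2 ^+ n * 4^-1 ^+ n) ?ler_wpM2l ?exprn_ge0 ?du//.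
  by rewrite -exprMn; congr (_ ^+ _); field.
have Sfin : (\int[mu]_x S x < +oo)%E.
  rewrite integral_nneseries//.
  (* The general term is [2^-n], in the shape of the library's halving series. *)
  apply: (@le_lt_trans _ _ (\sum_(n <oo) (2 / (2 ^ (n + 0.+1))%:R : R)%:E)%E).
    apply: lee_nneseries => [n _ _|n _]; first exact: integral_ge0.
    rewrite (le_trans (iD n))// lee_fin addn1 natrX exprVn exprS invfM mulrA.
    by rewrite divff// mul1r.
  by have /cvg_lim -> := @cvg_geometric_eseries_half R 2 0; rewrite ?ltry.
have S0 x : (0 <= S x)%E by exact: nneseries_ge0.
have iS : mu.-integrable [set: T] S.
  apply/integrableP; split=> //; apply: le_lt_trans Sfin.
  by under eq_integral do rewrite gee0_abs//.
pose E := [set x | S x < +oo]%E.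
have mE : measurable E.
  by rewrite -[E]setTI; exact: emeasurable_fun_infty_o.
have aeE : {ae mu, forall x, E x}.
  have := integrable_ae measurableT iS; apply: filterS => x /(_ I).
  by rewrite ge0_fin_numE.
(* Setting [u n] to zero off [E] makes the sequence converge everywhere, so that the limit is
   measurable. *)
pose w n := u n \_ E.
have wE n x : w n x = if x \in E then u n x else 0 by rewrite /w patchE.
have cw x : cvgn (w ^~ x).
  rewrite (_ : w ^~ x = fun n => if x \in E then u n x else 0); last first.
    by apply/funext => n; rewrite wE.
  have [xE|xE] := boolP (x \in E); last exact: is_cvg_cst.
  by apply: cvg_of_weighted_squares; move: xE; rewrite inE.
pose v x := limn (w ^~ x).
have mw n : measurable_fun [set: T] (w n).
  by apply/(measurable_restrictT _ mE); apply: measurable_funTS; have [] := su n.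
have mv : measurable_fun [set: T] v.
  by apply: (measurable_fun_cvg mw) => x _; exact: cw.
have mu2 n m : measurable_fun [set: T] (fun x => ((u n x - u m x) ^+ 2)%:E).
  by apply/measurable_EFinP/measurable_funX; have [] := sqintB (su n) (su m).
have le4 n : (\int[mu]_x ((u n x - v x) ^+ 2)%:E <= (4^-1 ^+ n)%:E)%E.
  have mwv m : measurable_fun [set: T] (fun x => ((w n x - w m x) ^+ 2)%:E).
    by apply/measurable_EFinP/measurable_funX/measurable_funB.
  have muv : measurable_fun [set: T] (fun x => ((u n x - v x) ^+ 2)%:E).
    apply/measurable_EFinP/measurable_funX/measurable_funB => //.
    by have [] := su n.
  have limw x : limn_einf (fun m => ((w n x - w m x) ^+ 2)%:E) =
      ((w n x - v x) ^+ 2)%:E.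
    have [//|->//] := @cvg_limn_einf_sup _ (fun m => ((w n x - w m x) ^+ 2)%:E)
      ((w n x - v x) ^+ 2)%:E _.
    apply: cvg_EFin; first exact: nearW.
    apply: (@continuous_cvg _ _ _ _ _ _ (fun t : R => t ^+ 2)).
      exact: exprn_continuous.
    by apply: cvgB; [exact: cvg_cst|exact: cw].
  rewrite (@ge0_ae_eq_integral _ _ _ mu _ _
      (fun x => ((w n x - v x) ^+ 2)%:E))//; last first.
  - by apply: filterS aeE => x Ex _; rewrite wE mem_set.
  - by move=> x _; rewrite lee_fin sqr_ge0.
  - by move=> x _; rewrite lee_fin sqr_ge0.
  - by apply/measurable_EFinP/measurable_funX/measurable_funB.
  rewrite -(eq_integral _ _ (fun x _ => limw x)).
  apply: (le_trans (fatou mu measurableT mwv _)).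
    by move=> m x _; rewrite lee_fin sqr_ge0.
  rewrite limn_einf_lim; apply: lime_le; first exact: is_cvg_einfs.
  apply: nearW => k.
  (* The infimum over the tail from [k] is bounded by its term of index [maxn n k], which is also at
     least [n], as the Cauchy bound requires. *)
  apply: (@le_trans _ _
      (\int[mu]_x ((w n x - w (maxn n k) x) ^+ 2)%:E)%E).
    by apply: ereal_inf_lbound; exists (maxn n k) => //=; exact: leq_maxr.
  apply: (@le_trans _ _ (\int[mu]_x ((u (maxn n k) x - u n x) ^+ 2)%:E)%E).
    apply: ge0_le_integral => //.
    - by move=> x _; rewrite lee_fin sqr_ge0.
    - move=> x _; rewrite lee_fin !wE -sqrrN opprB.
      by case: ifP => // _; rewrite subrr expr0n/= sqr_ge0.
  have [_ i2] := sqintB (su (maxn n k)) (su n).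
  by rewrite -Rintegral_EFin// lee_fin du// leq_maxl.
have suv n : sqint (fun x => u n x - v x).
  have muv : measurable_fun [set: T] (fun x => u n x - v x).
    by apply: measurable_funB => //; have [] := su n.
  split=> //; apply/integrableP; split.
    by apply/measurable_EFinP; exact: measurable_funX.
  under eq_integral do rewrite gee0_abs ?lee_fin ?sqr_ge0//.
  by rewrite (le_lt_trans (le4 n))// ltry.
exists v.
  have := sqintB (su 0%N) (suv 0%N); congr sqint; apply/funext => x.
  by rewrite opprB addrC subrK.
by move=> n; rewrite -lee_fin Rintegral_EFin//; have [] := suv n.
Qed.
End square_integrable.

(** * Complex L2 and orthogonal projections *)

Section complex_parts.
Variable R : realType.
Implicit Types x y : R[i].

Lemma cReD x y : complex.Re (x + y) = complex.Re x + complex.Re y.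
Proof. by case: x; case: y. Qed.
Lemma cImD x y : complex.Im (x + y) = complex.Im x + complex.Im y.
Proof. by case: x; case: y. Qed.
Lemma cReN x : complex.Re (- x) = - complex.Re x.
Proof. by case: x. Qed.
Lemma cImN x : complex.Im (- x) = - complex.Im x.
Proof. by case: x. Qed.
Lemma cReM x y : complex.Re (x * y) =
  complex.Re x * complex.Re y - complex.Im x * complex.Im y.
Proof. by case: x; case: y. Qed.
Lemma cImM x y : complex.Im (x * y) =
  complex.Re x * complex.Im y + complex.Im x * complex.Re y.
Proof. by case: x; case: y. Qed.
Lemma cReJ x : complex.Re (conjc x) = complex.Re x.
Proof. by case: x. Qed.
Lemma cImJ x : complex.Im (conjc x) = - complex.Im x.
Proof. by case: x. Qed.
Definition complex_partsE := (cReD, cImD, cReN, cImN, cReM, cImM, cReJ, cImJ).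

Lemma complex_ext x y : complex.Re x = complex.Re y -> complex.Im x = complex.Im y ->
  x = y.
Proof. by case: x; case: y => a b c e /= -> ->. Qed.

Lemma norm1P x : `|x| = 1 <-> complex.Re x ^+ 2 + complex.Im x ^+ 2 = 1.
Proof.
rewrite normc_def; split=> [/(congr1 (@complex.Re R))/= h|->].
  by rewrite -[RHS](expr1n _ 2) -h sqr_sqrtr// addr_ge0 ?sqr_ge0.
by rewrite sqrtr1.
Qed.

End complex_parts.

Section complex_L2.
Context {R : realType} {d : measure_display} {T : measurableType d}.
Variable mu : {measure set T -> \bar R}.
Implicit Types (f g h : T -> R[i]) (M S : set (T -> R[i])).

(* [rip] is the real part of the inner product of [L2]; as the subspaces are
   complex, orthogonality for [rip] is orthogonality. *)
Definition rip f g : R := \int[mu]_x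
  (complex.Re (f x) * complex.Re (g x) + complex.Im (f x) * complex.Im (g x)).

Definition nsq f : R := rip f f.

(** The working form of membership in [L2] (see [L2P]), to which the lemmas on real functions
    apply. *)
Definition csqint f := sqint mu (fun x => complex.Re (f x)) /\
  sqint mu (fun x => complex.Im (f x)).

Lemma csqint_rip f g : csqint f -> csqint g -> mu.-integrable [set: T] (EFin \o
  (fun x => complex.Re (f x) * complex.Re (g x) +
            complex.Im (f x) * complex.Im (g x))).
Proof.
move=> [f1 f2] [g1 g2].
exact: (integrableD measurableT (sqint_mul f1 g1) (sqint_mul f2 g2)).
Qed.

Lemma csqint_lin (a : R[i]) f g : csqint f -> csqint g ->
  csqint (fun x => a * f x + g x).
Proof.
move=> [f1 f2] [g1 g2]; split.
  have := sqintD (sqintB (sqintZ (complex.Re a) f1) (sqintZ (complex.Im a) f2)) g1.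
  by congr sqint; apply/funext => x; rewrite !complex_partsE.
have := sqintD (sqintD (sqintZ (complex.Re a) f2) (sqintZ (complex.Im a) f1)) g2.
by congr sqint; apply/funext => x; rewrite !complex_partsE.
Qed.

Lemma csqint0 : csqint (fun=> 0).
Proof.
have s0 : sqint mu (cst 0 : T -> R).
  split; first exact: measurable_cst.
  have := integrable0 mu [set: T].
  by apply: eq_integrable => // x _ /=; rewrite expr0n.
by split.
Qed.

Lemma csqintZ (a : R[i]) f : csqint f -> csqint (fun x => a * f x).
Proof.
move=> sf; have := csqint_lin a sf csqint0.
by congr csqint; apply/funext => x; rewrite addr0.
Qed.

Lemma csqintB f g : csqint f -> csqint g -> csqint (fun x => f x - g x).
Proof.
move=> sf sg; have := csqint_lin (-1) sg sf.
by congr csqint; apply/funext => x; rewrite mulN1r addrC.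
Qed.

Lemma ripC f g : rip f g = rip g f.
Proof. by apply: eq_Rintegral => x _; congr (_ + _); rewrite mulrC. Qed.

Lemma nsq_ge0 f : 0 <= nsq f.
Proof.
by apply: Rintegral_ge0 => x _; rewrite addr_ge0// -expr2 sqr_ge0.
Qed.

Lemma rip_lin (s t : R) f g h : csqint f -> csqint g -> csqint h ->
  rip (fun x => s%:C * f x + t%:C * g x) h = s * rip f h + t * rip g h.
Proof.
move=> sf sg sh; rewrite /rip -!RintegralZl//; try exact: csqint_rip.
rewrite -RintegralD//; last 2 first.
  by apply: integrableZ_EFin; exact: csqint_rip.
  by apply: integrableZ_EFin; exact: csqint_rip.
by apply: eq_Rintegral => x _; rewrite !complex_partsE /=; ring.
Qed.

Lemma nsq_lin (s t : R) f g : csqint f -> csqint g ->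
  nsq (fun x => s%:C * f x + t%:C * g x) =
  s ^+ 2 * nsq f + 2 * s * t * rip f g + t ^+ 2 * nsq g.
Proof.
move=> sf sg; have sl := csqint_lin s%:C sf (csqintZ t%:C sg).
rewrite /nsq rip_lin//.
by rewrite (ripC f) (ripC g (fun _ => _)) !rip_lin// (ripC g f); ring.
Qed.

Lemma ripB f g h : csqint f -> csqint g -> csqint h ->
  rip (fun x => f x - g x) h = rip f h - rip g h.
Proof.
move=> sf sg sh; have := rip_lin 1 (-1) sf sg sh.
rewrite mul1r mulN1r => <-; congr rip; apply/funext => x.
by rewrite mul1r rmorphN1 mulN1r.
Qed.

Lemma nsqB f g : csqint f -> csqint g ->
  nsq (fun x => f x - g x) = nsq f - 2 * rip f g + nsq g.
Proof.
move=> sf sg; rewrite (_ : (fun x => _) = (fun x => 1%:C * f x + (-1)%:C * g x)).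
  by rewrite nsq_lin//; ring.
by apply/funext => x; rewrite mul1r rmorphN1 mulN1r.
Qed.

(** Cauchy-Schwarz in weighted form, without square roots: expand the squared norms of [t f + g] and
    [t f - g], which are nonnegative. *)
Lemma rip_le (t : R) f g : 0 < t -> csqint f -> csqint g ->
  2 * `|rip f g| <= t * nsq f + nsq g / t.
Proof.
move=> t0 sf sg.
have h1 := nsq_ge0 (fun x => t%:C * f x + 1%:C * g x).
have h2 := nsq_ge0 (fun x => t%:C * f x + (-1)%:C * g x).
rewrite !nsq_lin// in h1 h2.
have -> : t * nsq f + nsq g / t = (t ^+ 2 * nsq f + nsq g) / t.
  by field; rewrite gt_eqF.
rewrite ler_pdivlMr//.
by case: (ler0P (rip f g)) => _; lra.
Qed.

(** Stands in for the triangle inequality in approximation arguments; it holds pointwise since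
    [|z + w|^2 <= 2 |z|^2 + 2 |w|^2]. *)
Lemma nsq_le (a : R[i]) f g : csqint f -> csqint g ->
  nsq (fun x => a * f x + g x) <=
  2 * (complex.Re a ^+ 2 + complex.Im a ^+ 2) * nsq f + 2 * nsq g.
Proof.
move=> sf sg; have sl := csqint_lin a sf sg.
rewrite /nsq /rip -!RintegralZl//; try exact: csqint_rip.
rewrite -RintegralD//; last 2 first.
  by apply: integrableZ_EFin; exact: csqint_rip.
  by apply: integrableZ_EFin; exact: csqint_rip.
apply: le_Rintegral => //; first exact: csqint_rip.
  by apply: integrableD_EFin; apply: integrableZ_EFin; exact: csqint_rip.
move=> x _; rewrite !complex_partsE.
set a1 := complex.Re a; set a2 := complex.Im a.
set f1 := complex.Re (f x); set f2 := complex.Im (f x).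
set g1 := complex.Re (g x); set g2 := complex.Im (g x).
have := sqr_ge0 (a1 * f1 - a2 * f2 - g1); have := sqr_ge0 (a1 * f2 + a2 * f1 - g2).
by lra.
Qed.

Lemma L2norm_sqr f : ((L2norm mu f) `^ 2 = \int[mu]_x
  ((complex.Re (f x) * complex.Re (f x) + complex.Im (f x) * complex.Im (f x))%:E))%E.
Proof.
rewrite /L2norm poweR_Lnorm//; apply: eq_integral => x _ /=.
rewrite powR_mulrn// ; congr (_%:E); case: (f x) => a b /=.
by rewrite real_normK ?num_real// sqr_sqrtr -?expr2// addr_ge0 ?sqr_ge0.
Qed.

Lemma L2P f : L2 mu f <-> csqint f.
Proof.
split=> [[[m1 m2] n]|sf]; last first.
  have [[m1 _] [m2 _]] := sf; split=> //.
  apply: (@lty_poweRy _ _ 2) => //; rewrite L2norm_sqr.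
  exact: integrable_lty (csqint_rip sf sf).
have := @poweR_lty _ _ 2 n; rewrite L2norm_sqr => i.
have mf : measurable_fun [set: T] (fun x =>
  complex.Re (f x) * complex.Re (f x) + complex.Im (f x) * complex.Im (f x)).
  by apply: measurable_funD; apply: measurable_funM.
have iff : mu.-integrable [set: T] (EFin \o (fun x =>
    complex.Re (f x) * complex.Re (f x) + complex.Im (f x) * complex.Im (f x))).
  apply/integrableP; split; first exact/measurable_EFinP.
  under eq_integral do rewrite gee0_abs ?lee_fin ?addr_ge0// -?expr2 ?sqr_ge0//.
  by [].
split; split=> //; apply: le_integrable iff => //.
- by apply/measurable_EFinP; exact: measurable_funX.
- move=> x _ /=; rewrite lee_fin !ger0_norm ?addr_ge0 -?expr2 ?sqr_ge0//.
  by rewrite lerDl sqr_ge0.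
- by apply/measurable_EFinP; exact: measurable_funX.
- move=> x _ /=; rewrite lee_fin !ger0_norm ?addr_ge0 -?expr2 ?sqr_ge0//.
  by rewrite lerDr sqr_ge0.
Qed.

Lemma L2norm_lt (e : R) f : 0 < e -> csqint f ->
  (L2norm mu f < e%:E)%E <-> nsq f < e ^+ 2.
Proof.
move=> e0 sf; have n0 : (0 <= L2norm mu f)%E by exact: Lnorm_ge0.
have [_ nfin] := (L2P f).2 sf.
have : (L2norm mu f) \is a fin_num by rewrite ge0_fin_numE.
move=> /fineK nE; rewrite /nsq -lte_fin Rintegral_EFin; last exact: csqint_rip.
rewrite -L2norm_sqr -nE poweR_EFin !lte_fin powR_mulrn ?fine_ge0//.
by rewrite ltr_pXn2r// ?nnegrE ?fine_ge0// ltW.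
Qed.

Lemma L2closureP S f : S `<=` L2 mu ->
  L2closure mu S f <->
  csqint f /\ forall e : R, 0 < e -> exists2 g, S g & nsq (fun x => f x - g x) < e.
Proof.
move=> SL; split=> [[/L2P sf apx]|[sf apx]]; split=> //.
- move=> e e0; have se : 0 < Num.sqrt e by rewrite sqrtr_gt0.
  have [g Sg fg] := apx _ se; exists g => //.
  rewrite -(sqr_sqrtr (ltW e0)); apply/L2norm_lt => //.
  by apply: csqintB => //; exact/L2P/SL.
- exact/L2P.
move=> e e0; have [g Sg fg] := apx _ (exprn_gt0 2 e0); exists g => //.
by apply/L2norm_lt => //; apply: csqintB => //; exact/L2P/SL.
Qed.

Lemma subset_L2closure S : S `<=` L2 mu -> S `<=` L2closure mu S.
Proof.
move=> SL f Sf; apply/L2closureP => //; split; first exact/L2P/SL.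
move=> e e0; exists f => //; rewrite (_ : nsq _ = 0)//.
under [X in nsq X]eq_fun do rewrite subrr.
rewrite /nsq /rip; under eq_Rintegral do rewrite /= mul0r addr0.
by rewrite Rintegral_cst// mul0r.
Qed.

Lemma closed_subspace_closure S : S `<=` L2 mu -> S (fun=> 0) ->
  (forall (a : R[i]) f g, S f -> S g -> S (fun x => a * f x + g x)) ->
  closed_subspace mu (L2closure mu S).
Proof.
move=> SL S0 Slin; have sS g : S g -> csqint g by move=> /SL/L2P.
have cL : L2closure mu S `<=` L2 mu by move=> f [].
split=> //.
- exact: subset_L2closure.
- move=> a f g /(L2closureP _ SL)[sf fa] /(L2closureP _ SL)[sg ga].
  apply/(L2closureP _ SL); split; first exact: csqint_lin.
  move=> e e0; pose A := complex.Re a ^+ 2 + complex.Im a ^+ 2.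
  have A0 : 0 <= A by rewrite addr_ge0 ?sqr_ge0.
  (* By [nsq_le] the two errors contribute at most [2 A e / (4 (A + 1))] and [2 e / 4]. The [+ 1]
     covers the case [a = 0]. *)
  have e1 : 0 < e / (4 * (A + 1)) by rewrite divr_gt0// mulr_gt0// ltr_wpDl.
  have [f' Sf' ff'] := fa _ e1; have [g' Sg' gg'] := ga _ (divr_gt0 e0 (ltr0Sn R 3)).
  exists (fun x => a * f' x + g' x); first exact: Slin.
  rewrite (_ : (fun x => _) =
    (fun x => a * (f x - f' x) + (g x - g' x))); last by apply/funext => x; ring.
  have h1 : csqint (fun x => f x - f' x) by apply: csqintB => //; exact: sS.
  have h2 : csqint (fun x => g x - g' x) by apply: csqintB => //; exact: sS.
  apply: (le_lt_trans (nsq_le a h1 h2)); rewrite -/A.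
  rewrite ltr_pdivlMr ?mulr_gt0// ?ltr_wpDl// in ff'.
  rewrite ltr_pdivlMr// in gg'.
  have := nsq_ge0 (fun x => f x - f' x).
  by lra.
- move=> f /(L2closureP _ cL)[sf fa]; apply/(L2closureP _ SL); split=> // e e0.
  have e4 := divr_gt0 e0 (ltr0Sn R 3).
  have [g /(L2closureP _ SL)[sg ga] fg] := fa _ e4.
  have [h Sh gh] := ga _ e4; exists h => //.
  rewrite (_ : (fun x => _) =
    (fun x => 1 * (f x - g x) + (g x - h x))); last by apply/funext => x; ring.
  have h1 : csqint (fun x => f x - g x) by exact: csqintB.
  have h2 : csqint (fun x => g x - h x) by apply: csqintB => //; exact: sS.
  apply: (le_lt_trans (nsq_le 1 h1 h2)) => /=.
  rewrite !ltr_pdivlMr// in fg gh.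
  by lra.
Qed.

End complex_L2.

(** * Orthogonal projection onto a closed subspace *)

Section projection.
Context {R : realType} {d : measure_display} {T : measurableType d}.
Variable mu : {measure set T -> \bar R}.
Implicit Types (f g h : T -> R[i]).

(** Real completeness applied to the real and the imaginary parts; adding their two bounds gives the
    factor 2. *)
Lemma nsq_complete (g : nat -> T -> R[i]) : (forall n, csqint mu (g n)) ->
  (forall n m, (n <= m)%N -> nsq mu (fun x => g m x - g n x) <= 4^-1 ^+ n) ->
  exists2 h, csqint mu h & forall n, nsq mu (fun x => g n x - h x) <= 2 * 4^-1 ^+ n.
Proof.
move=> sg dg.
have nsqE f : csqint mu f -> nsq mu f = \int[mu]_x (complex.Re (f x) ^+ 2) +
    \int[mu]_x (complex.Im (f x) ^+ 2).
  by move=> [[_ i1] [_ i2]]; rewrite -RintegralD.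
have [u su du] : exists2 u, sqint mu u &
    forall n, \int[mu]_x (complex.Re (g n x) - u x) ^+ 2 <= 4^-1 ^+ n.
  apply: sqint_complete => [n|n m nm]; first by have [] := sg n.
  apply: le_trans (dg _ _ nm); rewrite nsqE; last exact: csqintB.
  under eq_Rintegral do rewrite -cReN -cReD.
  by rewrite lerDl Rintegral_ge0// => x _; rewrite sqr_ge0.
have [v sv dv] : exists2 v, sqint mu v &
    forall n, \int[mu]_x (complex.Im (g n x) - v x) ^+ 2 <= 4^-1 ^+ n.
  apply: sqint_complete => [n|n m nm]; first by have [] := sg n.
  apply: le_trans (dg _ _ nm); rewrite nsqE; last exact: csqintB.
  under eq_Rintegral do rewrite -cImN -cImD.
  by rewrite lerDr Rintegral_ge0// => x _; rewrite sqr_ge0.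
exists (fun x => u x +i* v x); first by split.
move=> n; rewrite nsqE; last by apply: csqintB => //; split.
under eq_Rintegral do rewrite cReD cReN /=.
under [X in _ + X]eq_Rintegral do rewrite cImD cImN /=.
by have := du n; have := dv n; lra.
Qed.

(** Archimedean property and [n < 2^n]; it replaces passages to the limit below. *)
Lemma eq0_of_le_geometric (c C : R) : 0 <= c ->
  (forall n, c <= C * 2^-1 ^+ n) -> c = 0.
Proof.
move=> c0 cC; apply/eqP; rewrite eq_le c0 andbT leNgt; apply/negP => cp.
have Cc : 0 <= C / c.
  rewrite divr_ge0//; have := cC 0%N; rewrite expr0 mulr1; exact: le_trans.
have := archi_boundP Cc; set n := Num.bound _ => Cn.
have := cC n; rewrite exprVn ler_pdivlMr ?exprn_gt0// leNgt => /negP; apply.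
rewrite mulrC -ltr_pdivrMr//; apply: (lt_trans Cn).
by rewrite -natrX ltr_nat ltn_expl.
Qed.

(** A minimizing sequence for the distance from [f] to [M] is Cauchy by the parallelogram identity;
    its limit [h] lies in [M]. Orthogonality of [f - h] to [M] is obtained approximately along the
    sequence, with geometric error. *)
Lemma closed_subspace_projection M f : closed_subspace mu M -> L2 mu f ->
  exists2 g, M g & forall h, M h -> rip mu (fun x => f x - g x) h = 0.
Proof.
move=> [ML M0 Mlin Mcl] /L2P sf.
have sM g : M g -> csqint mu g by move=> /ML/L2P.
pose D := [set nsq mu (fun x => f x - g x) | g in M].
have D0 : has_inf D.
  split; first by exists (nsq mu (fun x => f x - 0)); exists (fun=> 0).
  by exists 0 => _ [g _ <-]; exact: nsq_ge0.
have dle g : M g -> inf D <= nsq mu (fun x => f x - g x).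
  by move=> Mg; apply: ge_inf; [exact: D0.2|exists g].
(* With this excess over the infimum, the parallelogram identity bounds the squared distance from
   [g n] to [g m] by [4^-n / 2 + 4^-m / 2], hence by [4^-n] when [n <= m]. *)
have e0 n : (0 : R) < 4^-1 ^+ n / 4 by rewrite divr_gt0// exprn_gt0// invr_gt0.
have /choice[g gP] : forall n, exists g,
    M g /\ nsq mu (fun x => f x - g x) < inf D + 4^-1 ^+ n / 4.
  by move=> n; have [_ [g Mg <-] lt] := inf_adherent (e0 n) D0; exists g.
have Mg n : M (g n) by have [] := gP n.
have sg n : csqint mu (g n) by exact: sM.
have sfg n : csqint mu (fun x => f x - g n x) by exact: csqintB.
have [h sh gh] : exists2 h, csqint mu h &
    forall n, nsq mu (fun x => g n x - h x) <= 2 * 4^-1 ^+ n.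
  apply: nsq_complete => // n m nm.
  (* the midpoint of [g n] and [g m] is in [M]: parallelogram identity *)
  have Mmid : M (fun x => (2^-1)%:C * g n x + ((2^-1)%:C * g m x + 0)).
    by apply: (Mlin) => //; exact: Mlin.
  have := dle _ Mmid.
  rewrite (_ : (fun x => f x - _) = (fun x => (2^-1)%:C * (f x - g n x) +
      (2^-1)%:C * (f x - g m x))); last first.
    apply/funext => x; rewrite addr0 !mulrBr addrACA -mulrDl -rmorphD/=.
    by rewrite (_ : 2^-1 + 2^-1 = 1) ?mul1r ?opprD//; field.
  rewrite nsq_lin//.
  rewrite (_ : (fun x => g m x - g n x) = (fun x => (f x - g n x) - (f x - g m x))).
    rewrite (nsqB (sfg n) (sfg m)); have := (gP n).2; have := (gP m).2.
    have : (4^-1 : R) ^+ m <= 4^-1 ^+ n.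
      by apply: ler_wiXn2l => //; rewrite ?invr_ge0// invf_le1// ler1n.
    by lra.
  by apply/funext => x; ring.
exists h.
  apply: Mcl; apply/(L2closureP _ ML); split=> // e e_gt0.
  have [n] : exists n, 2 * 4^-1 ^+ n < e.
    apply: contrapT => /forallNP H.
    suff : e = 0 by move=> e0'; rewrite e0' ltxx in e_gt0.
    apply: (@eq0_of_le_geometric _ 2) => [|n]; first exact: ltW.
    have /negP := H n; rewrite -leNgt => /le_trans; apply.
    by rewrite ler_pM2l// lerXn2r ?nnegrE//; lra.
  move=> ne; exists (g n) => //; apply: le_lt_trans ne; apply: le_trans (gh n).
  rewrite (_ : (fun x => h x - g n x) = (fun x => (-1)%:C * (g n x - h x) + 0%:C * 0)).
    rewrite nsq_lin//; [|exact: csqintB|exact: csqint0].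
    by rewrite expr0n/= mulr0 !mul0r !addr0 sqrrN expr1n mul1r.
  by apply/funext => x; rewrite rmorphN1 mulN1r mulr0 addr0 opprB.
move=> k Mk; have sk := sM _ Mk; apply/eqP; rewrite -normr_eq0; apply/eqP.
apply: (@eq0_of_le_geometric _ (nsq mu k + 2)) => // n.
have t0 : (0 : R) < 2^-1 ^+ n by rewrite exprn_gt0// invr_gt0.
have tt : (2^-1 ^+ n) ^+ 2 = 4^-1 ^+ n :> R.
  by rewrite -exprM mulnC exprM; congr (_ ^+ _); field.
have r1 : rip mu (fun x => f x - h x) k =
    rip mu (fun x => f x - g n x) k + rip mu (fun x => g n x - h x) k.
  by rewrite !ripB//; ring.
(* Weighted Cauchy-Schwarz with weight [2^-n], whose square is [4^-n]. *)
have r2 : 2 * `|rip mu (fun x => g n x - h x) k| <= 2^-1 ^+ n * (nsq mu k + 2).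
  rewrite ripC; have sgh := csqintB (sg n) sh.
  apply: (le_trans (rip_le t0 sk sgh)); rewrite mulrDr lerD2l ler_pdivrMr//.
  by apply: (le_trans (gh n)); rewrite -tt expr2; lra.
(* First variation: [g n + s k] is in [M], so it cannot be nearer to [f] than the infimum, which
   [g n] nearly attains. Take [s = 2^-n] and [s = - 2^-n]. *)
have r3 : 2 * `|rip mu (fun x => f x - g n x) k| <= 2^-1 ^+ n * (nsq mu k + 1).
  have key s : inf D <= nsq mu (fun x => f x - g n x) -
      2 * s * rip mu (fun x => f x - g n x) k + s ^+ 2 * nsq mu k.
    have Ms : M (fun x => s%:C * k x + g n x) by exact: Mlin.
    apply: (le_trans (dle _ Ms)).
    rewrite (_ : (fun x => _) = (fun x => 1%:C * (f x - g n x) + (- s)%:C * k x)).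
      by rewrite nsq_lin//; lra.
    by apply/funext => x; rewrite rmorphN; ring.
  have := key (2^-1 ^+ n); have := key (- 2^-1 ^+ n); rewrite sqrrN.
  have := (gP n).2; rewrite -tt expr2; set t := 2^-1 ^+ n in t0 *.
  set r := rip _ _ _; set N := nsq _ k => k1 k2 k3.
  rewrite -(ler_pM2l t0).
  by case: (ler0P r) => _; nra.
rewrite r1; have := ler_normD (rip mu (fun x => f x - g n x) k)
  (rip mu (fun x => g n x - h x) k).
by lra.
Qed.

End projection.

(** * Approximation of indicators and uniqueness in L1 *)

Section brosowski_deutsch.
Variable R : realType.

Lemma bernoulli_ineq (t : R) n : -1 <= t -> 1 + n%:R * t <= (1 + t) ^+ n.
Proof.
move=> t1; elim: n => [|n ih]; first by rewrite mul0r addr0 expr0.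
rewrite exprS; have h : 0 <= 1 + t by lra.
apply: le_trans (ler_wpM2l h ih); rewrite -natr1.
by have := mulr_ge0 (ler0n R n) (sqr_ge0 t); lra.
Qed.

Lemma exp_small (x e : R) : 0 <= x < 1 -> 0 < e -> exists N, forall n,
  (N <= n)%N -> x ^+ n <= e.
Proof.
move=> /andP[x0 x1] e0.
have : (GRing.exp x) @ \oo --> (0 : R) by apply: cvg_expr; rewrite ger0_norm.
move=> /cvgrPdist_le/(_ _ e0)[N _ H]; exists N => n /H/=.
by rewrite sub0r normrN ger0_norm// exprn_ge0.
Qed.

Variables (K : topologicalType) (A : set (K -> R)).
Hypothesis A_cst : forall c, A (fun=> c).
Hypothesis A_add : forall p q, A p -> A q -> A (fun x => p x + q x).
Hypothesis A_mul : forall p q, A p -> A q -> A (fun x => p x * q x).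
Hypothesis A_cont : forall p, A p -> continuous p.

Let A_exp p n : A p -> A (fun x => p x ^+ n).
Proof.
move=> Ap; elim: n => [|n ih]; first exact: A_cst.
by rewrite (_ : (fun x => _) = (fun x => p x * p x ^+ n));
  [exact: A_mul|apply/funext => x; rewrite exprS].
Qed.

Let A_onem p : A p -> A (fun x => 1 - p x).
Proof.
move=> Ap; rewrite (_ : (fun x => _) = (fun x => 1 + (-1) * p x)).
  by apply: A_add => //; exact: A_mul.
by apply/funext => x; rewrite mulN1r.
Qed.

(* The step functions [1 - (1 - q^n)^(2^n)] and the bounds below are those of
   the Brosowski-Deutsch proof of the Stone-Weierstrass theorem; the finite
   cover is replaced by the remark that the sets [W] satisfying [sep W] form an
   ideal. *)
Lemma approx_indicator (C U : set K) : compact C ->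
  (forall x, C x -> exists q c, [/\ A q, forall y, 0 <= q y <= 1, q x = 1, c < 1 &
     forall y, ~ U y -> q y <= c]) ->
  forall e, 0 < e -> exists r, [/\ A r, forall y, 0 <= r y <= 1,
    forall y, C y -> 1 - e <= r y & forall y, ~ U y -> r y <= e].
Proof.
move=> cC locq.
(* Separate tolerances on [W] and off [U]: a union halves the second one and keeps the first. *)
pose sep (W : set K) := forall a b : R, 0 < a -> 0 < b -> exists r, [/\ A r,
  forall y, 0 <= r y <= 1, forall y, W y -> 1 - a <= r y &
  forall y, ~ U y -> r y <= b].
suff sC : sep C by move=> e e0; exact: sC.
have sep0 : sep set0.
  move=> a b a0 b0; exists (fun=> 0); split=> //.
    by move=> _; rewrite lexx ler01.
  by move=> y _; exact: ltW.
have sepS V W : V `<=` W -> sep W -> sep V.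
  move=> VW sW a b a0 b0; have [r [Ar r01 rW rU]] := sW _ _ a0 b0.
  by exists r; split=> // y /VW; exact: rW.
have sepU V W : sep V -> sep W -> sep (V `|` W).
  move=> sV sW a b a0 b0; have b20 : 0 < b / 2 by rewrite divr_gt0.
  have [r [Ar r01 rV rU]] := sV _ _ a0 b20.
  have [s [As s01 sW' sU]] := sW _ _ a0 b20.
  (* On [V] or [W] one factor is at most [a] and the other at most 1; off [U] the value is at most
     [r + s]. *)
  exists (fun y => 1 - (1 - r y) * (1 - s y)); split.
  - by apply: A_onem; apply: A_mul; exact: A_onem.
  - by move=> y; have := r01 y; have := s01 y; nra.
  - move=> y VWy; have := r01 y; have := s01 y.
    by case: VWy => [/rV|/sW']; nra.
  - by move=> y nU; have := r01 y; have := s01 y; have := rU _ nU; have := sU _ nU; nra.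
have sep_loc x : C x -> exists2 W, nbhs x W & sep W.
  move=> /locq[q [c [Aq q01 qx c1 qU]]].
  (* A power of [q] is at most 1/4 off [U] and still 1 at [x], hence above 3/4 near [x]: the
     threshold 1/2 lies strictly between. The maximum with 0 allows for a negative [c]. *)
  have [m mc] : exists m, (Num.max c 0) ^+ m <= 4^-1.
    have [||N cN] := @exp_small (Num.max c 0) 4^-1.
    - by rewrite le_max lexx orbT/= gt_max c1 ltr01.
    - by rewrite invr_gt0.
    by exists N; exact: cN.
  pose s y := q y ^+ m.
  have As : A s by exact: A_exp.
  have s01 y : 0 <= s y <= 1.
    by have /andP[? ?] := q01 y; rewrite exprn_ge0//= exprn_ile1.
  have sU y : ~ U y -> s y <= 4^-1.
    move=> nU; apply: le_trans mc; apply: lerXn2r; rewrite ?nnegrE.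
    - by have /andP[] := q01 y.
    - by rewrite le_max lexx orbT.
    - by rewrite le_max qU.
  exists [set y | 3 / 4 < s y].
    have : 3 / 4 < s x by rewrite /s qx expr1n; lra.
    by move=> sx; have := A_cont As (lt_nbhsr sx).
  move=> a b a0 b0.
  have [|N1 aN] := @exp_small (2 / 3) a _ a0; first lra.
  have [|N2 bN] := @exp_small (2^-1) b _ b0; first lra.
  pose n := maxn N1 N2.
  (* Bernoulli bound for use off [U], where [2 s <= 1/2]. *)
  have bern y : 0 <= 1 - s y ^+ n <= 1 /\ 1 - (1 - s y ^+ n) ^+ (2 ^ n) <= (2 * s y) ^+ n.
    have /andP[s0 s1] := s01 y.
    have t0 : 0 <= s y ^+ n by rewrite exprn_ge0.
    have t1 : s y ^+ n <= 1 by rewrite exprn_ile1.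
    split; first by lra.
    have := @bernoulli_ineq (- s y ^+ n) (2 ^ n).
    by rewrite exprMn natrX; lra.
  exists (fun y => 1 - (1 - s y ^+ n) ^+ (2 ^ n)); split.
  - by apply: A_onem; apply: (A_exp); apply: A_onem; exact: A_exp.
  - move=> y; have [/andP[h0 h1] _] := bern y.
    have := exprn_ge0 (2 ^ n) h0; have := exprn_ile1 (2 ^ n) h0 h1; lra.
  - move=> y /= sy; rewrite lerD2l lerN2.
    have [/andP[h0 h1] _] := bern y; set t := s y ^+ n in h0 h1 *.
    have t0 : 0 <= t by lra.
    apply: le_trans (aN n (leq_maxl _ _)).
    (* Where [s > 3/4], [2^n t = (2 s)^n >= (3/2)^n]; since
       [(1 - t)^N (1 + N t) <= (1 - t^2)^N <= 1] with [N = 2^n], the power [(1 - t)^N] is at most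
       [(2/3)^n]. *)
    have ge1 : 1 <= (2 / 3 * (2 * s y)) ^+ n by apply: exprn_ege1; lra.
    have le1 : (1 - t) ^+ (2 ^ n) * (1 + (2 ^ n)%:R * t) <= 1.
      have tm : -1 <= t by lra.
      apply: le_trans (ler_wpM2l (exprn_ge0 _ h0) (bernoulli_ineq _ tm)) _.
      by rewrite -exprMn; apply: exprn_ile1; nra.
    have N0 := exprn_ge0 (2 ^ n) h0.
    have wE : (2 * s y) ^+ n = 2 ^+ n * t by rewrite exprMn.
    rewrite natrX in le1; rewrite exprMn wE in ge1.
    have p0 : 0 <= (2 / 3 : R) ^+ n by apply: exprn_ge0; lra.
    have := ler_wpM2l N0 ge1; have := ler_wpM2l p0 le1.
    set u := (1 - t) ^+ _ in N0 *; set v := (2 / 3) ^+ n in p0 *.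
    by have := mulr_ge0 p0 N0; lra.
  - move=> y /sU sy; have [_ /le_trans] := bern y; apply.
    apply: le_trans (bN n (leq_maxr _ _)).
    by have := s01 y; move=> ?; apply: lerXn2r; rewrite ?nnegrE; lra.
apply: contrapT => nsC.
(* If [C] itself is not separated, the differences of [C] with separated sets generate a proper
   filter; by compactness it clusters at a point of [C], which has a separated neighbourhood. *)
pose F := [set Z | exists2 W, sep W & C `\` W `<=` Z].
have FF : ProperFilter F.
  split.
    case=> W sW CW; apply: nsC; apply: sepS sW => x Cx.
    by apply: contrapT => nW; have [] := CW x.
  split.
  - by exists set0.
  - move=> Y Z [V sV CV] [W sW CW]; exists (V `|` W); first exact: sepU.
    move=> x [Cx nVW]; split; [apply: CV|apply: CW]; split=> // h.
      by apply: nVW; left.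
    by apply: nVW; right.
  - by move=> Y Z YZ [V sV CV]; exists V => //; apply: subset_trans YZ.
have FC : F C by exists set0 => //; exact: subDsetl.
have [x [Cx clx]] := cC F FF FC.
have [W xW sW] := sep_loc _ Cx.
have [] : ((C `\` W) `&` W) !=set0 by apply: clx => //; exists W.
by move=> y [[_ nW] Wy].
Qed.

End brosowski_deutsch.

(** * Integrable functions annihilated by a separating algebra *)

Section annihilator.
Context {R : realType} {K : topologicalZmodType}.
Variable sigma : probability (borel K) R.

Lemma open_borel (U : set K) : open U -> measurable (U : set (borel K)).
Proof. by move=> oU; apply: sub_sigma_algebra. Qed.

Lemma continuous_borel (p : K -> R) : continuous p ->
  measurable_fun [set: borel K] (p : borel K -> R).
Proof.
move=> cp; apply: (measurability _ (RGenOInfty.measurableE R)) => //.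
move=> _ [_ [x ->] <-]; rewrite setTI; apply: open_borel.
by apply: open_comp => [y _|]; [exact: cp|exact: rray_open].
Qed.

Lemma outer_approx (d : R) (E : set (borel K)) : normalized_haar sigma ->
  0 < d -> measurable E ->
  exists U : set K, [/\ open U, E `<=` U & (sigma (U `\` E) < d%:E)%E].
Proof.
move=> [_ outer _] d0 mE; have := outer E mE; set S := [set _ | _ in _] => SE.
have fE : sigma E \is a fin_num by exact: fin_num_measure.
have [|_ [U [oU EU] <-]] := @lb_ereal_inf_adherent _ S d d0; first by rewrite -SE.
rewrite -SE => lt; exists U; split=> //.
have mU : measurable (U : set (borel K)) by exact: open_borel.
have fU : sigma U \is a fin_num by exact: fin_num_measure.
rewrite measureD//; last by rewrite ltey_eq fU.
by rewrite setIidr// lteBlDl.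
Qed.

Variable A : set (K -> R).
Hypothesis A_cst : forall c, A (fun=> c).
Hypothesis A_add : forall p q, A p -> A q -> A (fun x => p x + q x).
Hypothesis A_mul : forall p q, A p -> A q -> A (fun x => p x * q x).
Hypothesis A_cont : forall p, A p -> continuous p.
Hypothesis A_sep : forall (U : set K) x, open U -> U x ->
  exists q c, [/\ A q, forall y, 0 <= q y <= 1, q x = 1, c < 1 &
     forall y, ~ U y -> q y <= c].

(** It suffices that [f] integrates to 0 over every Borel set [E]. Some [r] in [A] is uniformly
    close to the indicator of [E] outside a set of small measure, over which [|f|] has a small
    integral, while [f r] integrates to 0. *)
Lemma annihilator_ae0 (f : borel K -> R) : normalized_haar sigma ->
  compact [set: K] ->
  sigma.-integrable [set: borel K] (EFin \o f) ->
  (forall p, A p -> \int[sigma]_x (f x * p x) = 0) ->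
  {ae sigma, forall x, f x = 0}.
Proof.
move=> haar cK fi fA.
have mf : measurable_fun [set: borel K] f.
  by apply/measurable_EFinP; exact: measurable_int fi.
have nfi : sigma.-integrable [set: borel K] (EFin \o (fun x => `|f x|)).
  exact: integrable_norm.
suff key (E : set (borel K)) : measurable E -> \int[sigma]_(x in E) f x = 0.
  have : ae_eq sigma [set: borel K] (EFin \o f) (cst 0%E).
    apply: integral_ae_eq => //= E _ mE; rewrite integral0.
    have fE : sigma.-integrable E (EFin \o f) by exact: integrableS fi.
    by rewrite -[LHS]fineK ?integrable_fin_num//; congr EFin; exact: key.
  by apply: filterS => x /(_ I)[].
move=> mE; set a := Rintegral _ _ _.
pose I := \int[sigma]_x `|f x|.
have I0 : 0 <= I by apply: Rintegral_ge0.
suff small e : 0 < e -> `|a| <= e * I + e.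
  apply/eqP; rewrite -normr_eq0 eq_le normr_ge0 andbT; apply/ler_addgt0Pr => e e0.
  have I1 : 0 < I + 1 by rewrite ltr_wpDl.
  have := small _ (divr_gt0 e0 I1); rewrite -[X in _ + X]mulr1 -mulrDr divfK ?gt_eqF//.
  by rewrite add0r.
move=> e0; have [d [d0 dP]] := integral_normr_continuous fi e0.
have d20 : 0 < d / 2 by rewrite divr_gt0.
have [U [oU EU sU]] := outer_approx haar d20 mE.
have [V [oV EV sV]] := outer_approx haar d20 (measurableC mE).
have [mU mV] := (open_borel oU, open_borel oV).
(* [U] and [V] are open neighbourhoods of [E] and of its complement, so the complement of [V] is a
   compact subset of [U]. Only on [B] is [r] uncontrolled. *)
pose B : set (borel K) := U `&` V.
have mB : measurable B by exact: measurableI.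
have sB : (sigma B < d%:E)%E.
  apply: (@le_lt_trans _ _ (sigma ((U `\` E) `|` (V `\` ~` E)))).
    apply: le_measure; rewrite ?inE//.
      by apply: measurableU; apply: measurableD => //; exact: measurableC.
    move=> x [Ux Vx]; have [Ex|nEx] := pselect (E x); [right|left]; split=> //.
  apply: (le_lt_trans (measureU2 _ _ _)).
  - exact: measurableD.
  - by apply: measurableD => //; exact: measurableC.
  by rewrite [d in d%:E]splitr EFinD lteD.
have cC : compact (~` V).
  by apply: (subclosed_compact _ cK) => //; exact: open_closedC.
have [r [Ar r01 rC rU]] : exists r, [/\ A r, forall y, 0 <= r y <= 1,
    forall y, (~` V) y -> 1 - e <= r y & forall y, ~ U y -> r y <= e].
  apply: (approx_indicator A_cst A_add A_mul A_cont cC) => // x nVx.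
  apply: A_sep => //; apply: EU; apply: contrapT => nEx.
  by apply: nVx; exact: EV.
have mr : measurable_fun [set: borel K] (r : borel K -> R).
  by apply: continuous_borel; exact: A_cont.
have fri : sigma.-integrable [set: borel K] (EFin \o (fun x => f x * r x)).
  apply: le_integrable fi => //.
    by apply/measurable_EFinP; exact: measurable_funM.
  move=> x _ /=; rewrite lee_fin normrM ler_piMr//.
  by have /andP[? ?] := r01 x; rewrite ger0_norm.
have iE : sigma.-integrable [set: borel K] (EFin \o (f \_ E)).
  by rewrite -restrict_EFin -integrable_mkcond//; apply: integrableS fi.
have iB : sigma.-integrable [set: borel K] (EFin \o ((fun x => `|f x|) \_ B)).
  by rewrite -restrict_EFin -integrable_mkcond//; apply: integrableS nfi.
have -> : a = \int[sigma]_x ((f \_ E) x - f x * r x).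
  by rewrite RintegralB// fA// subr0 /a Rintegral_mkcond.
have idif : sigma.-integrable [set: borel K]
    (EFin \o (fun x => (f \_ E) x - f x * r x)).
  have := integrableB measurableT iE fri.
  by apply: eq_integrable => // x _ /=; rewrite EFinB.
apply: (le_trans (le_normr_Rintegral measurableT idif)).
(* Off [B], a point of [E] is outside [V] and a point outside [E] is outside [U], so [r] is within
   [e] of the indicator; on [B] the difference is at most [|f|]. *)
apply: (@le_trans _ _ (\int[sigma]_x (e * `|f x| + ((fun x => `|f x|) \_ B) x))).
  apply: le_Rintegral => //; first exact: integrable_norm.
    by apply: integrableD_EFin => //; apply: integrableZ_EFin.
  move=> x _; have /andP[r0 r1] := r01 x; have nf0 := normr_ge0 (f x).
  rewrite !patchE; have [/set_mem Ex|/negP nEx] := boolP (x \in E).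
    have -> : f x - f x * r x = f x * (1 - r x) by ring.
    rewrite normrM (ger0_norm (_ : 0 <= 1 - r x)) ?subr_ge0//.
    have Ux := EU _ Ex; have [_|/negP nBx] := boolP (x \in B); first nra.
    have nVx : ~ V x by move=> Vx; apply: nBx; rewrite inE.
    rewrite addr0 mulrC; apply: ler_wpM2r => //.
    by have := rC _ nVx; lra.
  rewrite sub0r normrN normrM (ger0_norm r0).
  have [_|/negP nBx] := boolP (x \in B); first nra.
  have nUx : ~ U x.
    move=> Ux; apply: nBx; rewrite inE; split=> //.
    by apply: EV => Ex; apply: nEx; rewrite inE.
  rewrite addr0 mulrC; apply: ler_wpM2r => //.
  exact: rU.
rewrite RintegralD//; last exact: integrableZ_EFin.
rewrite RintegralZl// lerD2l -Rintegral_mkcond.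
by apply: ltW; exact: dP.
Qed.

End annihilator.

(** * Characters and Fourier coefficients *)

Section dual_group.
Context {R : realType} {K : topologicalZmodType} {Gam : zmodType}.
Variable ev : K -> Gam -> R[i].
Hypothesis dev : is_dual ev.

Let c (l : Gam) (x : K) : R := complex.Re (ev x l).
Let s (l : Gam) (x : K) : R := complex.Im (ev x l).

Lemma char_sqr x l : c l x ^+ 2 + s l x ^+ 2 = 1.
Proof. by apply/norm1P; have [_ n1] := dual_char dev x. Qed.

Lemma ev0 x : ev x 0 = 1.
Proof.
have [evD n1] := dual_char dev x; have := evD 0 0; rewrite addr0.
have nz : ev x 0 != 0 by rewrite -normr_eq0 n1 oner_eq0.
by move/(congr1 (fun z => z / ev x 0)); rewrite mulfK// divff.
Qed.

Lemma evN x l : ev x (- l) = conjc (ev x l).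
Proof.
have [evD n1] := dual_char dev x.
have nz : ev x l != 0 by rewrite -normr_eq0 n1 oner_eq0.
apply: (mulfI nz); rewrite -evD subrr ev0.
by rewrite -sqr_normc n1 expr1n.
Qed.

Lemma char_bound l x : `|c l x| <= 1 /\ `|s l x| <= 1.
Proof.
by have := char_sqr x l; move=> h; rewrite !ler_norml; split; apply/andP; split; nra.
Qed.

(** Relates the subbasic neighbourhoods of [x] to a trigonometric polynomial in [y]. *)
Lemma ev_normB x y l : (c l y - c l x) ^+ 2 + (s l y - s l x) ^+ 2 =
  2 - 2 * (c l x * c l y + s l x * s l y).
Proof. by have := char_sqr x l; have := char_sqr y l; lra. Qed.

Let near_ev (x : K) (e : R) (l : Gam) : set K :=
  [set y | (c l y - c l x) ^+ 2 + (s l y - s l x) ^+ 2 < e ^+ 2].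

Lemma normC_lt (z : R[i]) (e : R) : 0 < e ->
  (`|z| < e%:C) = (complex.Re z ^+ 2 + complex.Im z ^+ 2 < e ^+ 2).
Proof.
move=> e0; rewrite normc_def ltcR.
have h : 0 <= complex.Re z ^+ 2 + complex.Im z ^+ 2 by rewrite addr_ge0 ?sqr_ge0.
by rewrite -[in RHS](sqr_sqrtr h) ltr_pXn2r// nnegrE ?sqrtr_ge0// ltW.
Qed.

Lemma nbhs_near_ev x e l : 0 < e -> nbhs x (near_ev x e l).
Proof.
move=> e0.
have cev : ev @ nbhs x --> (ev x : {ptws Gam -> R[i]^o}).
  move=> B; rewrite nbhsE => -[B' [oB' B'x] B'B].
  rewrite nbhs_simpl nbhsE/=; exists (ev @^-1` B'); last by move=> y /B'B.
  by split=> //; apply/(dual_top dev); exists B'.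
have cl : (fun y => ev y l : R[i]^o) @ nbhs x --> (ev x l : R[i]^o).
  have := @proj_continuous Gam (fun=> R[i]^o) l (ev x).
  exact: cvg_comp cev.
have /cvgrPdist_lt/(_ e%:C) := cl.
rewrite ltcR => /(_ e0).
rewrite /nbhs/=; apply: filterS => y /=.
rewrite distrC normC_lt// !complex_partsE.
by [].
Qed.

(* The sets [near_ev x e l] form a subbasis of neighbourhoods of [x]. *)
Lemma filter_near_ev x (F : set_system K) : Filter F ->
  (forall e l, 0 < e -> F (near_ev x e l)) ->
  forall U : set K, open U -> U x -> F U.
Proof.
move=> FF Fx U /(dual_top dev)[B oB UE] Ux.
have cev : ev @ F --> (ev x : {ptws Gam -> R[i]^o}).
  apply/cvg_sup => l V; rewrite nbhsE => -[W [[C oC <-] Cx] CV].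
  have /nbhs_ballP[e /= e0 eC] : nbhs (ev x l : R[i]^o) C by exact: open_nbhs_nbhs.
  (* In the order of [R[i]] a positive element is real. *)
  have [e1 eE] : 0 < complex.Re e /\ e = (complex.Re e)%:C.
    by move: e0; case: e {eC} => a b; rewrite ltcE/= => /andP[/eqP -> a0].
  rewrite -[_ V]/(F (ev @^-1` V)).
  apply: filterS (Fx _ l e1) => y /= h; apply: CV; apply: eC.
  by rewrite /ball/= distrC eE normC_lt// !complex_partsE.
have := cev B; rewrite UE; apply.
by apply: open_nbhs_nbhs; split=> //; rewrite UE in Ux.
Qed.

Lemma continuous_char l : continuous (c l) /\ continuous (s l).
Proof.
split=> x; apply/cvgrPdist_lt => e e0;
  apply: filterS (nbhs_near_ev x l e0) => y /= h;
  rewrite -ltr_sqr ?nnegrE ?normr_ge0 ?(ltW e0)// real_normK ?num_real//;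
  apply: le_lt_trans h; rewrite -sqrrN opprB.
  by rewrite lerDl sqr_ge0.
by rewrite lerDr sqr_ge0.
Qed.

Variable sigma : probability (borel K) R.

Definition no_spectrum (f : borel K -> R) :=
  sigma.-integrable [set: borel K] (EFin \o f) /\
  forall l, \int[sigma]_x (f x * c l x) = 0 /\ \int[sigma]_x (f x * s l x) = 0.

(** Stability under products is immediate for this class, so trigonometric polynomials need not be
    handled explicitly. *)
Definition multiplier (p : K -> R) :=
  continuous p /\ forall f, no_spectrum f -> no_spectrum (fun x => f x * p x).

Lemma measurable_char l : measurable_fun [set: borel K] (c l : borel K -> R) /\
  measurable_fun [set: borel K] (s l : borel K -> R).
Proof. by have [? ?] := continuous_char l; split; exact: continuous_borel. Qed.

Lemma integrableM_le1 (f g : borel K -> R) :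
  sigma.-integrable [set: borel K] (EFin \o f) ->
  measurable_fun [set: borel K] g -> (forall x, `|g x| <= 1) ->
  sigma.-integrable [set: borel K] (EFin \o (fun x => f x * g x)).
Proof.
move=> fi mg g1; apply: (le_integrable measurableT _ _ fi).
  apply/measurable_EFinP/measurable_funM => //.
  by apply/measurable_EFinP; exact: measurable_int fi.
by move=> x _ /=; rewrite lee_fin normrM ler_piMr.
Qed.

Lemma integrableM_char (f : borel K -> R) l :
  sigma.-integrable [set: borel K] (EFin \o f) ->
  sigma.-integrable [set: borel K] (EFin \o (fun x => f x * c l x)) /\
  sigma.-integrable [set: borel K] (EFin \o (fun x => f x * s l x)).
Proof.
move=> fi; have [mc ms] := measurable_char l.
by split; apply: integrableM_le1 => // x; have [] := char_bound l x.
Qed.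

Lemma Rintegral_lin (a b : R) (f g : borel K -> R) :
  sigma.-integrable [set: borel K] (EFin \o f) ->
  sigma.-integrable [set: borel K] (EFin \o g) ->
  \int[sigma]_x (a * f x + b * g x) =
  a * \int[sigma]_x f x + b * \int[sigma]_x g x.
Proof.
move=> fi gi; rewrite RintegralD//; try exact: integrableZ_EFin.
by rewrite !RintegralZl.
Qed.

Lemma multiplier_cst a : multiplier (fun=> a).
Proof.
split; first by move=> x; exact: cvg_cst.
move=> f [fi f0].
have -> : (fun x => f x * a) = (fun x => a * f x).
  by apply/funext => x; rewrite mulrC.
split=> [|l]; first exact: integrableZ_EFin.
have [ic iS] := integrableM_char l fi; have [fc fs] := f0 l.
under eq_Rintegral do rewrite -mulrA.
rewrite RintegralZl// fc mulr0; split=> //.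
under eq_Rintegral do rewrite -mulrA.
by rewrite RintegralZl// fs mulr0.
Qed.

Lemma multiplier_add p q : multiplier p -> multiplier q ->
  multiplier (fun x => p x + q x).
Proof.
move=> [cp mp] [cq mq]; split; first by move=> x; apply: cvgD; [exact: cp|exact: cq].
move=> f nf; have [[fpi fp0] [fqi fq0]] := (mp _ nf, mq _ nf).
have -> : (fun x => f x * (p x + q x)) = (fun x => f x * p x + f x * q x).
  by apply/funext => x; rewrite mulrDr.
split=> [|l]; first exact: integrableD_EFin.
have [[ic1 is1] [ic2 is2]] := (integrableM_char l fpi, integrableM_char l fqi).
have [[h1 h2] [h3 h4]] := (fp0 l, fq0 l).
split; under eq_Rintegral do rewrite mulrDl.
  by rewrite RintegralD// h1 h3 addr0.
by rewrite RintegralD// h2 h4 addr0.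
Qed.

Lemma multiplier_mul p q : multiplier p -> multiplier q ->
  multiplier (fun x => p x * q x).
Proof.
move=> [cp mp] [cq mq]; split; first by move=> x; apply: cvgM; [exact: cp|exact: cq].
move=> f nf; have := mq _ (mp _ nf).
by congr no_spectrum; apply/funext => x; rewrite mulrA.
Qed.

(** Product-to-sum formulas: multiplying by [c m] or [s m] turns coefficients at [l] into
    combinations of those at [m + l] and [m - l]. *)
Lemma multiplier_char m : multiplier (c m) /\ multiplier (s m).
Proof.
have [cc cs] := continuous_char m.
have cD l x : c (m + l) x = c m x * c l x - s m x * s l x.
  by rewrite /c (charD (dual_char dev x)) cReM.
have sD l x : s (m + l) x = c m x * s l x + s m x * c l x.
  by rewrite /s (charD (dual_char dev x)) cImM.
have cB l x : c (m - l) x = c m x * c l x + s m x * s l x.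
  by rewrite /c (charD (dual_char dev x)) evN !complex_partsE mulrN opprK.
have sB l x : s (m - l) x = - (c m x * s l x) + s m x * c l x.
  by rewrite /s (charD (dual_char dev x)) evN !complex_partsE mulrN.
split; split=> // f [fi f0]; have [ifc ifs] := integrableM_char m fi; split=> // l.
  all: have [[ic1 is1] [ic2 is2]] :=
  (integrableM_char (m + l) fi, integrableM_char (m - l) fi).
  all: have [[h1 h2] [h3 h4]] := (f0 (m + l), f0 (m - l)).
- split.
    transitivity (\int[sigma]_x
      (2^-1 * (f x * c (m + l) x) + 2^-1 * (f x * c (m - l) x))).
      by apply: eq_Rintegral => x _; rewrite cD cB; field.
    by rewrite Rintegral_lin// h1 h3 !mulr0 addr0.
  transitivity (\int[sigma]_x
    (2^-1 * (f x * s (m + l) x) + (- 2^-1) * (f x * s (m - l) x))).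
    by apply: eq_Rintegral => x _; rewrite sD sB; field.
  by rewrite Rintegral_lin// h2 h4 !mulr0 addr0.
- split.
    transitivity (\int[sigma]_x
      (2^-1 * (f x * s (m + l) x) + 2^-1 * (f x * s (m - l) x))).
      by apply: eq_Rintegral => x _; rewrite sD sB; field.
    by rewrite Rintegral_lin// h2 h4 !mulr0 addr0.
  transitivity (\int[sigma]_x
    ((- 2^-1) * (f x * c (m + l) x) + 2^-1 * (f x * c (m - l) x))).
    by apply: eq_Rintegral => x _; rewrite cD cB; field.
  by rewrite Rintegral_lin// h1 h3 !mulr0 addr0.
Qed.

(** The sets whose complement is so separated from [x] form a filter, intersections being handled by
    products; by [filter_near_ev] the subbasic neighbourhoods are enough. *)
Lemma multiplier_sep (U : set K) x : open U -> U x ->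
  exists q a, [/\ multiplier q, forall y, 0 <= q y <= 1, q x = 1, a < 1 &
    forall y, ~ U y -> q y <= a].
Proof.
pose F := [set Z : set K | exists q a, [/\ multiplier q, forall y, 0 <= q y <= 1,
  q x = 1, a < 1 & forall y, ~ Z y -> q y <= a]].
suff : forall U : set K, open U -> U x -> F U by exact.
apply: filter_near_ev.
  split.
  - exists (fun=> 1), 0; split=> //; first exact: multiplier_cst.
      by move=> _; rewrite lexx ler01.
    by move=> y [].
  - move=> Y Z [p [a [mp p01 px a1 pY]]] [q [b [mq q01 qx b1 qZ]]].
    exists (fun y => p y * q y), (Num.max a b); split.
    + exact: multiplier_mul.
    + move=> y; have /andP[? ?] := p01 y; have /andP[? ?] := q01 y.
      by rewrite mulr_ge0//= mulr_ile1.
    + by rewrite px qx mulr1.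
    + by rewrite gt_max a1 b1.
    + move=> y nYZ; have /andP[? ?] := p01 y; have /andP[? ?] := q01 y.
      rewrite le_max; have [Yy|/pY pa] := pselect (Y y); last first.
        by apply/orP; left; apply: le_trans pa; rewrite ler_piMr.
      have /qZ qb : ~ Z y by move=> Zy; apply: nYZ.
      by apply/orP; right; apply: le_trans qb; rewrite ler_piMl.
  - move=> Y Z YZ [p [a [mp p01 px a1 pY]]]; exists p, a; split=> // y nZ.
    by apply: pY => /YZ.
move=> e l e0; have [mc ms] := multiplier_char l.
(* By [ev_normB] this function is [1 - |ev y l - ev x l|^2 / 4], which peaks at [x]. *)
exists (fun y => 2^-1 * (1 + (c l x * c l y + s l x * s l y))), (1 - e ^+ 2 / 4).
have e20 : 0 < e ^+ 2 by rewrite exprn_gt0.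
split.
- apply: multiplier_mul; first exact: multiplier_cst.
  apply: multiplier_add; first exact: multiplier_cst.
  by apply: multiplier_add; apply: multiplier_mul => //; exact: multiplier_cst.
- move=> y; have := ev_normB x y l.
  have := sqr_ge0 (c l y - c l x); have := sqr_ge0 (s l y - s l x).
  have := sqr_ge0 (c l y + c l x); have := sqr_ge0 (s l y + s l x).
  have := char_sqr x l; have := char_sqr y l.
  by move=> *; apply/andP; split; lra.
- by rewrite -!expr2 char_sqr; field.
- by lra.
- by move=> y /negP; rewrite -leNgt ev_normB; lra.
Qed.

(** For a multiplier [p], the coefficient of [f p] at 0 is its integral; thus [f] annihilates the
    separating algebra of multipliers. *)
Lemma no_spectrum_ae0 (f : borel K -> R) : normalized_haar sigma ->
  compact [set: K] -> no_spectrum f -> {ae sigma, forall x, f x = 0}.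
Proof.
move=> haar cK nf; have [fi _] := nf.
apply: (annihilator_ae0 multiplier_cst multiplier_add multiplier_mul _
  multiplier_sep haar cK fi) => [p []//|p [_ /(_ _ nf)[_ /(_ 0)[h _]]]].
by rewrite -h; apply: eq_Rintegral => x _; rewrite /c ev0 mulr1.
Qed.

Lemma Rintegral_translation (y : K) (g : K -> R) : normalized_haar sigma ->
  continuous g -> sigma.-integrable [set: borel K] (EFin \o g) ->
  sigma.-integrable [set: borel K] (EFin \o (fun x : K => g (y + x))) ->
  \int[sigma]_x (g (y + (x : K))) = \int[sigma]_x g x.
Proof.
move=> [inv _ _] cg gi gyi.
pose phi (x : borel K) : borel K := y + (x : K).
have mphi : measurable_fun [set: borel K] phi.
  apply: (@measurability _ _ (borel K) (borel K) setT phi (@open K)) => //.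
  move=> _ [U oU <-]; rewrite setTI; apply: open_borel.
  apply: open_comp => // x _.
  apply: (@cvg_comp _ _ _ (fun z : K => (y, z)) (fun w : K * K => w.1 + w.2) _
    (nbhs (y, x))); last first.
    have add_cont : continuous (fun w : K * K => w.1 + w.2).
      exact: tvs.add_continuous.
    exact: (add_cont (y, x)).
  by apply: cvg_pair; [exact: cvg_cst|exact: cvg_id].
congr fine.
have mg : measurable_fun [set: borel K] (EFin \o g).
  by apply/measurable_EFinP; exact: continuous_borel.
transitivity (\int[pushforward sigma phi]_x (g x)%:E)%E.
  by rewrite (integral_pushforward mphi mg gyi measurableT).
apply: eq_measure_integral.
(* The preimage of [A] under translation by [y] is the translate of [A] by [- y]. *)
move=> A mA _; apply: etrans (inv (- y) A mA); rewrite /= /pushforward; congr (sigma _).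
apply/seteqP; split=> [x Ax|_ [x Ax <-]].
  by exists (y + x) => //; rewrite addrA addNr add0r.
by rewrite /preimage/phi/= addrA subrr add0r.
Qed.

(** Translation by [y] multiplies the integral of the character by [ev y l]. In real terms this is a
    linear system of determinant [|1 - ev y l|^2], nonzero. *)
Lemma Rintegral_char0 l y : normalized_haar sigma -> ev y l != 1 ->
  \int[sigma]_x c l x = 0 /\ \int[sigma]_x s l x = 0.
Proof.
move=> haar y1; have [cc cs] := continuous_char l.
have i1 : sigma.-integrable [set: borel K] (EFin \o (fun=> 1 : R)).
  exact: finite_measure_integrable_cst.
have [ic iS] : sigma.-integrable [set: borel K] (EFin \o (c l : borel K -> R)) /\
    sigma.-integrable [set: borel K] (EFin \o (s l : borel K -> R)).
  have [h1 h2] := integrableM_char l i1; split.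
    by apply: eq_integrable h1 => // x _ /=; rewrite mul1r.
  by apply: eq_integrable h2 => // x _ /=; rewrite mul1r.
have cD x : c l (y + x) = c l y * c l x + (- s l y) * s l x.
  by rewrite /c (dualD dev) cReM mulNr.
have sD x : s l (y + x) = s l y * c l x + c l y * s l x.
  by rewrite /s (dualD dev) cImM addrC.
have ty a b : sigma.-integrable [set: borel K]
    (EFin \o (fun x : borel K => a * c l x + b * s l x)).
  by apply: integrableD_EFin; exact: integrableZ_EFin.
have h1 : s l y * \int[sigma]_x c l x + c l y * \int[sigma]_x s l x =
    \int[sigma]_x s l x.
  rewrite -Rintegral_lin// -(Rintegral_translation (y := y) haar cs iS) => [|].
    by apply: eq_Rintegral => x _; rewrite sD.
  by apply: eq_integrable (ty (s l y) (c l y)) => // x _ /=; rewrite sD.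
have h2 : c l y * \int[sigma]_x c l x + - s l y * \int[sigma]_x s l x =
    \int[sigma]_x c l x.
  rewrite -Rintegral_lin// -(Rintegral_translation (y := y) haar cc ic) => [|].
    by apply: eq_Rintegral => x _; rewrite cD.
  by apply: eq_integrable (ty (c l y) (- s l y)) => // x _ /=; rewrite cD.
set I := Rintegral _ _ _ in h1 h2 *; set J := Rintegral _ _ _ in h1 h2 *.
have D0 : (1 - c l y) ^+ 2 + s l y ^+ 2 != 0.
  apply: contra y1; rewrite paddr_eq0 ?sqr_ge0// !sqrf_eq0 subr_eq0.
  by move=> /andP[/eqP h /eqP h0]; apply/eqP/complex_ext; [exact: esym h|exact: h0].
split; apply: (mulfI D0); rewrite mulr0.
  have -> : ((1 - c l y) ^+ 2 + s l y ^+ 2) * I =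
      (1 - c l y) * (I - (c l y * I + - s l y * J)) -
      s l y * (J - (s l y * I + c l y * J)) by ring.
  by rewrite h1 h2 !subrr !mulr0 subr0.
have -> : ((1 - c l y) ^+ 2 + s l y ^+ 2) * J =
    (1 - c l y) * (J - (s l y * I + c l y * J)) +
    s l y * (I - (c l y * I + - s l y * J)) by ring.
by rewrite h1 h2 !subrr !mulr0 addr0.
Qed.

End dual_group.

(** * Linear spans *)

Lemma linear_span_sub (R : realType) (T : Type) (S N : set (T -> R[i])) :
  N (fun=> 0) ->
  (forall (a : R[i]) f g, N f -> N g -> N (fun x => a * f x + g x)) ->
  S `<=` N -> linear_span S `<=` N.
Proof.
move=> N0 Nlin SN _ [n [c [g [Sg ->]]]].
elim: n c g Sg => [|n ih] c g Sg.
  rewrite (_ : (fun x => _) = (fun=> 0))//.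
  by apply/funext => x; rewrite big_ord0.
rewrite (_ : (fun x => _) = (fun x => c ord0 * g ord0 x +
    \sum_(i < n) c (lift ord0 i) * g (lift ord0 i) x)).
  by apply: (Nlin); [exact: SN|exact: ih].
by apply/funext => x; rewrite big_ord_recl.
Qed.

Lemma linear_span0 (R : realType) (T : Type) (S : set (T -> R[i])) :
  linear_span S (fun=> 0).
Proof.
exists 0%N, (fun=> 0), (fun _ _ => 0); split; first by case.
by apply/funext => x; rewrite big_ord0.
Qed.

Lemma linear_span_lin (R : realType) (T : Type) (S : set (T -> R[i])) (a : R[i]) f g :
  linear_span S f -> linear_span S g -> linear_span S (fun x => a * f x + g x).
Proof.
move=> [n [c [u [Su ->]]]] [m [e [v [Sv ->]]]].
exists (n + m)%N,
  (fun i => match fintype.split i with inl j => a * c j | inr j => e j end),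
  (fun i => match fintype.split i with inl j => u j | inr j => v j end); split.
  by move=> i; case: (fintype.split i).
apply/funext => x; rewrite big_split_ord/= mulr_sumr; congr (_ + _).
  by apply: eq_bigr => i _; rewrite (unsplitK (inl i)) mulrA.
by apply: eq_bigr => i _; rewrite (unsplitK (inr i)).
Qed.

Lemma sub_linear_span (R : realType) (T : Type) (S : set (T -> R[i])) :
  S `<=` linear_span S.
Proof.
move=> f Sf; exists 1%N, (fun=> 1), (fun=> f); split=> //.
by apply/funext => x; rewrite big_ord1 mul1r.
Qed.

(** * Multiplication by unimodular functions and a.e. equality *)

Section unimodular.
Context {R : realType} {d : measure_display} {T : measurableType d}.
Variable mu : {measure set T -> \bar R}.
Implicit Types f g u : T -> R[i].

Lemma cmeasurableM f g : cmeasurable f -> cmeasurable g ->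
  cmeasurable (fun x => f x * g x).
Proof.
move=> [f1 f2] [g1 g2]; split.
  under eq_fun do rewrite cReM.
  by apply: measurable_funB; apply: measurable_funM.
under eq_fun do rewrite cImM.
by apply: measurable_funD; apply: measurable_funM.
Qed.

Lemma cmeasurableJ f : cmeasurable f -> cmeasurable (fun x => conjc (f x)).
Proof.
move=> [f1 f2]; split; first by under eq_fun do rewrite cReJ.
by under eq_fun do rewrite cImJ; exact: measurableT_comp.
Qed.

Lemma csqint_cmeasurable f : csqint mu f -> cmeasurable f.
Proof. by move=> [[? _] [? _]]. Qed.

Lemma csqintM_unimod u f : cmeasurable u -> {ae mu, forall x, `|u x| = 1} ->
  csqint mu f -> csqint mu (fun x => u x * f x).
Proof.
move=> mu1 u1 sf; have mf := csqint_cmeasurable sf.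
have mm g : cmeasurable g -> measurable_fun [set: T] (fun x =>
  (complex.Re (g x) * complex.Re (g x) + complex.Im (g x) * complex.Im (g x))%:E).
  by move=> [g1 g2]; apply/measurable_EFinP/measurable_funD; apply: measurable_funM.
apply/L2P; split; first exact: cmeasurableM.
apply: (@lty_poweRy _ _ 2) => //; rewrite L2norm_sqr.
rewrite (@ge0_ae_eq_integral _ _ _ mu _ _ (fun x =>
  (complex.Re (f x) * complex.Re (f x) + complex.Im (f x) * complex.Im (f x))%:E))//.
- exact: integrable_lty (csqint_rip sf sf).
- exact: mm (cmeasurableM mu1 mf).
- exact: mm.
- by move=> x _; rewrite lee_fin addr_ge0// -expr2 sqr_ge0.
- by move=> x _; rewrite lee_fin addr_ge0// -expr2 sqr_ge0.
apply: filterS u1 => x /norm1P ux _; congr (_%:E); rewrite !complex_partsE.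
set u1 := complex.Re (u x) in ux *; set u2 := complex.Im (u x) in ux *.
rewrite -[RHS]mul1r -ux; ring.
Qed.

Lemma rip_ae f f' g : csqint mu f -> csqint mu f' -> csqint mu g ->
  {ae mu, forall x, f x = f' x} -> rip mu f g = rip mu f' g.
Proof.
move=> sf sf' sg ff'; congr fine; apply: ae_eq_integral => //.
- by have := csqint_rip sf sg => /measurable_int.
- by have := csqint_rip sf' sg => /measurable_int.
by apply: filterS ff' => x /= -> _.
Qed.

Lemma rip_mulJ u f g : rip mu (fun x => conjc (u x) * f x) g =
  rip mu f (fun x => u x * g x).
Proof. by apply: eq_Rintegral => x _; rewrite !complex_partsE; ring. Qed.

Lemma rip0l g : rip mu (fun=> 0) g = 0.
Proof.
rewrite /rip; under eq_Rintegral do rewrite /= !mul0r addr0.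
by rewrite Rintegral_cst// mul0r.
Qed.

Lemma nsq_ae0 f : csqint mu f -> {ae mu, forall x, f x = 0} -> nsq mu f = 0.
Proof.
by move=> sf f0; rewrite /nsq (rip_ae sf (csqint0 mu) sf f0) rip0l.
Qed.

(** Closed subspaces are saturated for a.e. equality. *)
Lemma L2closure_nsq0 S f g : closed_subspace mu S -> csqint mu f -> S g ->
  nsq mu (fun x => f x - g x) = 0 -> S f.
Proof.
move=> [SL S0 Slin Scl] sf Sg fg; apply: Scl; apply/L2closureP => //; split=> //.
by move=> e e0; exists g => //; rewrite fg.
Qed.

End unimodular.

(** * Fourier coefficients of square integrable functions *)

Section fourier.
Context {R : realType} {K : topologicalZmodType} {Gam : zmodType}.
Variable ev : K -> Gam -> R[i].
Hypothesis dev : is_dual ev.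
Variable sigma : probability (borel K) R.
Local Notation ii := (0 +i* 1 : R[i]).

Lemma cmeasurable_chi l : cmeasurable (chi ev l : borel K -> R[i]).
Proof. exact: measurable_char dev l. Qed.

Lemma chi_norm1 l : {ae sigma, forall x, `|chi ev l x| = 1}.
Proof. by apply: aeW => x; rewrite /chi (char_norm1 (dual_char dev x)). Qed.

Lemma csqintM_chi l f : csqint sigma f -> csqint sigma (fun x => chi ev l x * f x).
Proof. by apply: csqintM_unimod; [exact: cmeasurable_chi|exact: chi_norm1]. Qed.

Lemma sqint1 : sqint sigma (fun=> 1).
Proof.
split; first exact: measurable_cst.
have : sigma.-integrable [set: borel K] (EFin \o (fun=> 1 : R)).
  exact: finite_measure_integrable_cst.
by apply: eq_integrable => // x _ /=; rewrite expr1n.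
Qed.

Lemma csqint1 : csqint sigma (fun=> 1).
Proof.
split; first exact: sqint1.
exact: (csqint0 sigma).1.
Qed.

Lemma csqint_chi l : csqint sigma (chi ev l).
Proof.
by have := csqintM_chi l csqint1; congr csqint; apply/funext => x; rewrite mulr1.
Qed.

(** The imaginary part of a complex inner product is the real part of the one with [i] times the
    second vector. *)
Lemma fourier_eq0 f l : fourier ev sigma f l = 0 <->
  rip sigma f (chi ev l) = 0 /\ rip sigma f (fun x => ii * chi ev l x) = 0.
Proof.
have -> : fourier ev sigma f l =
    rip sigma f (chi ev l) +i* rip sigma f (fun x => ii * chi ev l x).
  rewrite /fourier /cintegral; congr (_ +i* _); apply: eq_Rintegral => x _;
    by rewrite !complex_partsE /=; ring.
by split=> [[-> ->]|[-> ->]].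
Qed.

Lemma fourier_ae0 k : normalized_haar sigma -> compact [set: K] ->
  csqint sigma k -> (forall l, fourier ev sigma k l = 0) ->
  {ae sigma, forall x, k x = 0}.
Proof.
move=> haar cK sk k0; have [s1 s2] := sk.
have ik (p : borel K -> R) : sqint sigma p ->
    sigma.-integrable [set: borel K] (EFin \o p).
  move=> /sqint_mul/(_ sqint1).
  by apply: eq_integrable => // x _ /=; rewrite mulr1.
have [n1 n2] : no_spectrum ev sigma (fun x => complex.Re (k x)) /\
    no_spectrum ev sigma (fun x => complex.Im (k x)).
  suff H l : [/\ \int[sigma]_x (complex.Re (k x) * complex.Re (ev x l)) = 0,
      \int[sigma]_x (complex.Re (k x) * complex.Im (ev x l)) = 0,
      \int[sigma]_x (complex.Im (k x) * complex.Re (ev x l)) = 0 &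
      \int[sigma]_x (complex.Im (k x) * complex.Im (ev x l)) = 0].
    by split; split=> [|l]; try exact: ik; have [] := H l.
  have [i1 i2] := integrableM_char dev l (ik _ s1).
  have [i3 i4] := integrableM_char dev l (ik _ s2).
  (* The coefficients at [l] and [- l] give four real equations, which split into separate ones for
     the real and imaginary parts of [k]. *)
  have /fourier_eq0[] := k0 l; have /fourier_eq0[] := k0 (- l).
  set P := \int[sigma]_x (complex.Re (k x) * complex.Re (ev x l)).
  set Q := \int[sigma]_x (complex.Re (k x) * complex.Im (ev x l)).
  set S := \int[sigma]_x (complex.Im (k x) * complex.Re (ev x l)).
  set W := \int[sigma]_x (complex.Im (k x) * complex.Im (ev x l)).
  have -> : rip sigma k (chi ev l) = 1 * P + 1 * W.
    by rewrite -Rintegral_lin//; apply: eq_Rintegral => x _; rewrite !mul1r.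
  have -> : rip sigma k (chi ev (- l)) = 1 * P + (-1) * W.
    rewrite -Rintegral_lin//; apply: eq_Rintegral => x _.
    by rewrite /chi (evN dev) !complex_partsE; ring.
  have -> : rip sigma k (fun x => ii * chi ev l x) = (-1) * Q + 1 * S.
    rewrite -Rintegral_lin//; apply: eq_Rintegral => x _.
    by rewrite /chi !complex_partsE/=; ring.
  have -> : rip sigma k (fun x => ii * chi ev (- l) x) = 1 * Q + 1 * S.
    rewrite -Rintegral_lin//; apply: eq_Rintegral => x _.
    by rewrite /chi (evN dev) !complex_partsE/=; ring.
  by move=> *; split; lra.
have r0 := no_spectrum_ae0 dev haar cK n1; have i0 := no_spectrum_ae0 dev haar cK n2.
by apply: filterS2 r0 i0 => x r i; exact: complex_ext.
Qed.

End fourier.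

(** * Simply invariant subspaces *)

Section simply_invariant.
Context {R : realType} {Gam : zmodType} {K : topologicalZmodType}.
Variables (pos : set Gam) (ev : K -> Gam -> R[i]).
Variables (sigma : probability (borel K) R) (M : set (borel K -> R[i])).
Hypotheses (gpos : group_order pos) (cK : compact [set: K]) (dev : is_dual ev).
Hypotheses (haar : normalized_haar sigma) (cM : closed_subspace sigma M).
Hypothesis MmM : Mminus ev pos sigma M `<` M.
Hypothesis Minv : forall l, (pos `|` [set 0]) l -> mulset (chi ev l) M `<=` M.

Local Notation ii := (0 +i* 1 : R[i]).
Local Notation Mm := (Mminus ev pos sigma M).
Local Notation genMm :=
  (\bigcup_(l in pos) mulset (chi ev l) M : set (borel K -> R[i])).

Let sM f : M f -> csqint sigma f. Proof. by move=> /(csub_L2 cM)/L2P. Qed.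

Let MZ (a : R[i]) f : M f -> M (fun x => a * f x).
Proof.
move=> Mf; have := csub_lin cM a Mf (csub0 cM).
by congr M; apply/funext => x; rewrite addr0.
Qed.

Let Mchi l f : (pos `|` [set 0]) l -> M f -> M (fun x => chi ev l x * f x).
Proof. by move=> l0 Mf; apply: (Minv l0); exists f. Qed.

Let span_sub_M : linear_span genMm `<=` M.
Proof.
apply: linear_span_sub; [exact: csub0 cM|exact: csub_lin cM|].
by move=> _ [l pl [f Mf <-]]; apply: Mchi => //; left.
Qed.

Let span_L2 : linear_span genMm `<=` L2 sigma.
Proof. exact: subset_trans span_sub_M (csub_L2 cM). Qed.

Let cMm : closed_subspace sigma Mm.
Proof.
apply: closed_subspace_closure; first exact: span_L2.
  exact: linear_span0.
exact: linear_span_lin.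
Qed.

Let Mm_chi (a : R[i]) l f : pos l -> M f -> Mm (fun x => a * (chi ev l x * f x)).
Proof.
move=> pl Mf; apply: (@subset_L2closure R _ (borel K) sigma _ span_L2).
apply: sub_linear_span; exists l => //; exists (fun x => a * f x); first exact: MZ.
by apply/funext => x; rewrite mulrCA.
Qed.

Let trichotomy l : [\/ pos l, l = 0 | pos (- l)].
Proof.
have : (pos `|` [set 0] `|` -%R @` pos) l by rewrite (pos_cover gpos).
move=> [[pl|->]|[m pm <-]]; [by constructor 1|by constructor 2|].
by constructor 3; rewrite opprK.
Qed.

(** Project an element of [M] outside [Mm] onto [Mm] and normalize the residual, which is nonzero
    because [Mm] is closed. *)
Lemma wandering_vector : exists phi, [/\ M phi, nsq sigma phi = 1 &
  forall h, Mm h -> rip sigma phi h = 0].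
Proof.
have [MmsubM /existsNP[f /not_implyP[Mf nMmf]]] := MmM.
have [g Mmg fg] := closed_subspace_projection cMm (csub_L2 cM Mf).
pose u x := f x - g x.
have Mu : M u.
  have := csub_lin cM (-1) (MmsubM _ Mmg) Mf; congr M; apply/funext => x.
  by rewrite mulN1r addrC.
have su := sM Mu.
have u0 : 0 < nsq sigma u.
  rewrite lt_neqAle nsq_ge0 andbT eq_sym; apply/eqP => u0.
  by apply: nMmf; apply: L2closure_nsq0 u0 => //; exact: sM.
pose t := (Num.sqrt (nsq sigma u))^-1.
have tE : t ^+ 2 * nsq sigma u = 1.
  by rewrite exprVn sqr_sqrtr ?mulVf ?gt_eqF// ltW.
have phiE : (fun x => t%:C * u x) = (fun x => t%:C * u x + 0%:C * u x).
  by apply/funext => x; rewrite mul0r addr0.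
exists (fun x => t%:C * u x); split; first exact: MZ.
  by rewrite phiE nsq_lin// tE; ring.
move=> h Mmh; rewrite phiE rip_lin//; last exact/sM/MmsubM.
by rewrite fg// !mulr0 addr0.
Qed.

(** The coefficients of [|phi|^2] vanish at [l > 0] by orthogonality and at [l < 0] by conjugation,
    the function being real; at 0 the normalization gives 1. *)
Lemma unimodular_wandering phi : M phi -> nsq sigma phi = 1 ->
  (forall h, Mm h -> rip sigma phi h = 0) ->
  {ae sigma, forall x, `|phi x| = 1}.
Proof.
move=> Mphi phi1 orth; have sphi := sM Mphi.
pose w (x : borel K) : R := complex.Re (phi x) * complex.Re (phi x) +
  complex.Im (phi x) * complex.Im (phi x).
have iw : sigma.-integrable [set: borel K] (EFin \o w) by exact: csqint_rip.
have posw l : pos l -> \int[sigma]_x (w x * complex.Re (ev x l)) = 0 /\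
    \int[sigma]_x (w x * complex.Im (ev x l)) = 0.
  move=> pl; split.
    have <- := orth _ (Mm_chi 1 pl Mphi); apply: eq_Rintegral => x _.
    by rewrite /w /chi !complex_partsE/=; ring.
  (* The scalar [- i] turns the real inner product into the integral against the imaginary part of
     the character. *)
  rewrite -[RHS](orth _ (Mm_chi (- ii) pl Mphi)); apply: eq_Rintegral => x _.
  by rewrite /w /chi !complex_partsE/=; ring.
have w0 l : l != 0 -> \int[sigma]_x (w x * complex.Re (ev x l)) = 0 /\
    \int[sigma]_x (w x * complex.Im (ev x l)) = 0.
  move=> l0; have [/posw//|l0'|/posw[h1 h2]] := trichotomy l.
    by rewrite l0' eqxx in l0.
  have [_ i2] := integrableM_char dev (- l) iw.
  split; first by rewrite -[RHS]h1; apply: eq_Rintegral => x _; rewrite (evN dev) cReJ.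
  transitivity (-1 * \int[sigma]_x (w x * complex.Im (ev x (- l)))).
    rewrite -RintegralZl//; apply: eq_Rintegral => x _.
    by rewrite (evN dev) cImJ; ring.
  by rewrite h2 mulr0.
have i1 : sigma.-integrable [set: borel K] (EFin \o (fun=> 1 : R)).
  exact: finite_measure_integrable_cst.
have int1 : \int[sigma]_x (1 : R) = 1.
  rewrite Rintegral_cst// mul1r -[RHS]/(fine (1%:E : \bar R)).
  by congr fine; exact: probability_setT.
have ns : no_spectrum ev sigma (fun x => 1 * w x + (-1) * 1).
  split; first by apply: integrableD_EFin; exact: integrableZ_EFin.
  move=> l; have [iwc iws] := integrableM_char dev l iw.
  have [i1c i1s] := integrableM_char dev l i1.
  have E p : sigma.-integrable [set: borel K] (EFin \o (fun x => w x * p x)) ->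
      sigma.-integrable [set: borel K] (EFin \o (fun x => 1 * p x)) ->
      \int[sigma]_x ((1 * w x + (-1) * 1) * p x) =
      \int[sigma]_x (w x * p x) - \int[sigma]_x (1 * p x).
    move=> h1 h2; rewrite -RintegralB//.
    by apply: eq_Rintegral => x _; ring.
  rewrite !E//; have [->|l0] := eqVneq l 0.
    split.
      under eq_Rintegral do rewrite (ev0 dev) mulr1.
      under [X in _ - X]eq_Rintegral do rewrite (ev0 dev) mulr1.
      by rewrite int1 -[X in _ - X]phi1 subrr.
    under eq_Rintegral do rewrite (ev0 dev) mulr0.
    under [X in _ - X]eq_Rintegral do rewrite (ev0 dev) mulr0.
    by rewrite subrr.
  have [h1 h2] := w0 _ l0; rewrite h1 h2 !sub0r.
  (* If the character at [l] were identically 1, the vanishing coefficient [h1] would be the squared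
     norm of [phi], which is 1. *)
  have [y y1] : exists y, ev y l != 1.
    apply: contrapT => /forallNP ev1.
    have := h1; under eq_Rintegral.
      move=> x _; have /negP := ev1 x; rewrite negbK => /eqP ->.
      rewrite mulr1; over.
    by rewrite -[LHS]/(nsq sigma phi) phi1 => /eqP; rewrite oner_eq0.
  have [c0 s0] := Rintegral_char0 dev haar y1.
  by split; under eq_Rintegral do rewrite mul1r; rewrite ?c0 ?s0 oppr0.
have := no_spectrum_ae0 dev haar cK ns; apply: filterS => x wx.
by apply/norm1P; move: wx; rewrite /w; lra.
Qed.

Lemma simply_invariant_Hardy : exists phi : borel K -> R[i],
  [/\ cmeasurable phi, {ae sigma, forall x, `|phi x| = 1} &
      M = ae_mulset sigma phi (H2 ev pos sigma)].
Proof.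
have [phi [Mphi phi1 orth]] := wandering_vector.
have uphi := unimodular_wandering Mphi phi1 orth.
have sphi := sM Mphi; have mphi := csqint_cmeasurable sphi.
have mphiJ := cmeasurableJ mphi.
have uphiJ : {ae sigma, forall x, `|conjc (phi x)| = 1}.
  by apply: filterS uphi => x; rewrite normcJ.
have phiJK f : {ae sigma, forall x, f x = phi x * (conjc (phi x) * f x)}.
  by apply: filterS uphi => x ux; rewrite mulrA -sqr_normc ux expr1n mul1r.
have sub_phiH2 f : M f ->
    exists2 g, H2 ev pos sigma g & {ae sigma, forall x, f x = phi x * g x}.
  move=> Mf; exists (fun x => conjc (phi x) * f x); last exact: phiJK.
  split; first by apply/L2P; apply: csqintM_unimod => //; exact: sM.
  move=> _ [l pl <-]; apply/fourier_eq0.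
  (* Since [chi (- l)] is the conjugate of [chi l], this is the inner product of [phi] with a
     multiple of [chi l * f], an element of [Mm]. *)
  have key (a : R[i]) : rip sigma (fun x => conjc (phi x) * f x)
      (fun x => a * chi ev (- l) x) = 0.
    rewrite -(orth _ (Mm_chi (conjc a) pl Mf)).
    by apply: eq_Rintegral => x _; rewrite /chi (evN dev) !complex_partsE; ring.
  split; last exact: key.
  by rewrite -[RHS](key 1); congr rip; apply/funext => x; rewrite mul1r.
exists phi; split=> //; apply/seteqP; split=> [f Mf|h [/L2P sh [g [/L2P sg g0] hg]]].
  by split; [exact: csub_L2 cM _ Mf|exact: sub_phiH2].
(* With [m = phi g'] a.e. by the first inclusion, the residual [h - m] is [phi] times [k = g - g'];
   the goal becomes [k = 0] a.e. *)
have [m Mm0 hm] := closed_subspace_projection cM ((L2P sigma h).2 sh).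
have [g' [/L2P sg' g0'] mg] := sub_phiH2 _ Mm0.
have sm := sM Mm0; have sn := csqintB sh sm; have sk := csqintB sg sg'.
have nk : {ae sigma, forall x, h x - m x = phi x * (g x - g' x)}.
  by apply: filterS2 hg mg => x -> ->; rewrite mulrBr.
have kn : {ae sigma, forall x, g x - g' x = conjc (phi x) * (h x - m x)}.
  apply: filterS2 uphi nk => x ux ->.
  by rewrite mulrA (mulrC (conjc _)) -sqr_normc ux expr1n mul1r.
have k0 : {ae sigma, forall x, g x - g' x = 0}.
  apply: (fourier_ae0 dev haar cK sk) => l.
  (* For [l >= 0] the residual is orthogonal to [chi l * phi], which is in [M]; for [l < 0] both [g]
     and [g'] are in [H2]. *)
  have [pl|nl] : (pos `|` [set 0]) l \/ (-%R @` pos) l.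
    have [pl|->|pl] := trichotomy l; [by left; left|by left; right|right].
    by exists (- l) => //; rewrite opprK.
  - have key (a : R[i]) : rip sigma (fun x => g x - g' x)
        (fun x => a * chi ev l x) = 0.
      have sJ : csqint sigma (fun x => conjc (phi x) * (h x - m x)).
        exact: csqintM_unimod.
      have sa : csqint sigma (fun x => a * chi ev l x).
        exact/csqintZ/csqint_chi.
      rewrite (rip_ae sk sJ sa kn) rip_mulJ -(hm _ (MZ a (Mchi pl Mphi))).
      by congr rip; apply/funext => x; rewrite mulrC -mulrA.
    apply/fourier_eq0; split; last exact: key.
    by rewrite -[RHS](key 1); congr rip; apply/funext => x; rewrite mul1r.
  have /fourier_eq0[h1 h2] := g0 _ nl; have /fourier_eq0[h3 h4] := g0' _ nl.
  have sc := csqint_chi dev sigma l.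
  apply/fourier_eq0; rewrite !ripB//; last exact: csqintZ.
  by rewrite h1 h2 h3 h4 subrr.
apply: (L2closure_nsq0 cM sh Mm0); apply: nsq_ae0 => //.
by apply: filterS2 nk k0 => x -> ->; rewrite mulr0.
Qed.

End simply_invariant.

Unset Implicit Arguments.

Theorem theorem4p3 (R : realType) (Gam : zmodType) (pos : set Gam)
    (K : topologicalZmodType) (ev : K -> Gam -> R[i])
    (sigma : probability (borel K) R) (M : set (borel K -> R[i])) :
  group_order pos ->
  compact [set: K] ->
  is_dual ev ->
  normalized_haar sigma ->
  closed_subspace sigma M ->
  Mminus ev pos sigma M `<` M ->
  (forall l, (pos `|` [set 0]) l -> mulset (chi ev l) M `<=` M) ->
  exists phi : borel K -> R[i],
    [/\ cmeasurable phi,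
        {ae sigma, forall x, `|phi x| = 1} &
        M = ae_mulset sigma phi (H2 ev pos sigma)].
Proof.
move=> gpos cK dev haar cM MmM Minv.
exact: (simply_invariant_Hardy gpos cK dev haar cM MmM Minv).
Qed.
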